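(* Let $T_j(x)$ denote the $j$-th Chebyshev polynomial of the first kind, let $i=\sqrt{-1}$, and let $\zeta_{h,d}:=\cos\left(\frac{(2h-1)\pi}{4d}\right)$ for all integers $h$ and $d\neq 0$. Then for all integers $m,n\geq 1$, the following four numbers are equal: (1) the number of symmetric recurrents on the sandpile grid graph $\mathrm{S}\Gamma_{(2m-1)\times(2n-1)}$; (2) the number of domino tilings of the $2$-weighted checkerboard of size $2m\times 2n$, counted according to weight; (3) $(-1)^{mn}\,2^m\prod_{h=1}^m T_{2n}(i\,\zeta_{h,m})$; (4) $\prod_{h=1}^{m}\prod_{k=1}^{n}\left(4\,\zeta_{h,m}^2+4\,\zeta_{k,n}^2\right)$.
   Context: Chebyshev polynomials of the first kind: $T_0(x)=1$, $T_1(x)=x$, $T_j(x)=2x\,T_{j-1}(x)-T_{j-2}(x)$ for $j\ge 2$. Grid graph: for integers $p,q\ge1$, $\Gamma_{p\times q}$ is the undirected graph with vertex set $[p]\times[q]$ and edges $\{(a,b),(a',b')\}$ with $|a-a'|+|b-b'|=1$. The sandpile grid graph $\mathrm{S}\Gamma_{p\times q}$ is obtained from $\Gamma_{p\times q}$ by adding a new vertex $s$ (the sink) and, for each grid vertex $v$, an edge between $v$ and $s$ of weight $4-\deg_{\Gamma_{p\times q}}(v)$ (no edge if this is $0$), so that every non-sink vertex has total degree $4$. Recurrents: a configuration on $\mathrm{S}\Gamma_{p\times q}$ is a function $c\colon[p]\times[q]\to\mathbb{N}=\{0,1,2,\dots\}$. A vertex $v$ is unstable in $c$ if $c_v\ge4$;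 firing an unstable $v$ subtracts $4$ from $c_v$ and adds $1$ to $c_w$ for each neighbor $w$ of $v$ in $\Gamma_{p\times q}$. Repeatedly firing unstable vertices always leads, after finitely many steps, to a stable configuration (one with no unstable vertices) $c^\circ$ that depends only on $c$. A configuration $c$ is recurrent if it is stable and for every configuration $a$ there is a configuration $b$ with $(a+b)^\circ=c$. A symmetric recurrent on $\mathrm{S}\Gamma_{p\times q}$ is a recurrent configuration $c$ such that $c_{(a,b)}=c_{(a,q-b+1)}=c_{(p-a+1,b)}$ for all $(a,b)\in[p]\times[q]$. $2$-weighted checkerboard: the $2$-weighted $2m\times2n$ grid graph is $\Gamma_{2m\times2n}$ where each horizontal edge $\{(2m-2h,2n-1),(2m-2h,2n)\}$ with $0\le h<m$ and each vertical edge $\{(2m-1,2n-2k),(2m,2n-2k)\}$ with $0\le k<n$ has weight $2$, and all other edges have weight $1$. Domino tilings of the $2$-weighted $2m\times2n$ checkerboard are the perfect matchings of this graph, the weight of a matching is the product of the weights of its edges, and counting according to weight means taking the sum of the weights of all perfect matchings. *)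

(* Defs.v *)
From Stdlib Require Export Relation_Operators.
From mathcomp Require Export all_boot all_order all_algebra.
From mathcomp Require Export all_classical all_reals all_analysis.
From mathcomp Require Export complex.

Set Implicit Arguments.
Unset Strict Implicit.
Unset Printing Implicit Defensive.

Import Order.TTheory GRing.Theory Num.Theory.

(* The ordinals are 0-based: the vertex (a, b) of [p] x [q] is encoded by the
   pair of ordinals of values a - 1 and b - 1, and [coords] recovers (a, b). *)
Definition grid (p q : nat) : finType := ('I_p * 'I_q)%type.

Definition coords p q (v : grid p q) : nat * nat := (v.1.+1, v.2.+1).

Definition grid_adj p q : rel (grid p q) := fun v w =>
  (`|(coords v).1 - (coords w).1| + `|(coords v).2 - (coords w).2| == 1)%N.

Definition config (p q : nat) : Type := {ffun grid p q -> nat}.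

Definition unstable p q (c : config p q) (v : grid p q) : bool := (4 <= c v)%N.

Definition stable p q (c : config p q) : bool := [forall v, ~~ unstable c v].

(* The edges to the sink bring the total degree of each vertex to exactly 4;
   the grains they carry are lost, so the sink needs no vertex of its own. *)
Definition fire p q (c : config p q) (v : grid p q) : config p q :=
  [ffun w => if w == v then (c v - 4)%N else (c w + grid_adj v w)%N].

Definition firing_step p q (c d : config p q) : Prop :=
  exists v, unstable c v /\ d = fire c v.

(* The graph of the stabilization map: [stabilizes_to c d] means c° = d. *)
Definition stabilizes_to p q (c d : config p q) : Prop :=
  clos_refl_trans (config p q) (@firing_step p q) c d /\ stable d.

Definition recurrent p q (c : config p q) : Prop :=
  stable c /\
  forall a : config p q, exists b : config p q,
    stabilizes_to [ffun v => (a v + b v)%N] c.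

(* [rev_ord] is a |-> p - a + 1 on 1-based coordinates. *)
Definition symmetric_config p q (c : config p q) : Prop :=
  forall (a : 'I_p) (b : 'I_q),
    c (a, b) = c (a, rev_ord b) /\ c (a, b) = c (rev_ord a, b).

Definition symmetric_recurrents p q : set (config p q) :=
  [set c | recurrent c /\ symmetric_config c]%classic.
Arguments symmetric_recurrents : clear implicits.

Definition grid_edges p q : {set {set grid p q}} :=
  [set e | [exists v, exists w, grid_adj v w && (e == [set v; w]%SET)]]%SET.

Definition perfect_matching p q (M : {set {set grid p q}}) : bool :=
  (M \subset grid_edges p q) &&
  [forall v, #|[set e in M | v \in e]%SET| == 1%N].

(* The vertices whose 1-based coordinates are x or y. *)
Definition edge_at p q (x y : nat * nat) : {set grid p q} :=
  [set v | coords v \in [:: x; y]]%SET.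

Definition edge_weight m n (e : {set grid (2 * m) (2 * n)}) : nat :=
  if [exists h : 'I_m,
        e == edge_at _ _ (2 * m - 2 * h, 2 * n - 1) (2 * m - 2 * h, 2 * n)]%N
  || [exists k : 'I_n,
        e == edge_at _ _ (2 * m - 1, 2 * n - 2 * k) (2 * m, 2 * n - 2 * k)]%N
  then 2%N else 1%N.

Definition weighted_domino_tilings (m n : nat) : nat :=
  (\sum_(M : {set {set grid (2 * m) (2 * n)}} | perfect_matching M)
     \prod_(e in M) edge_weight e)%N.

Local Open Scope ring_scope.

Fixpoint chebyshevT (K : nzRingType) (j : nat) : {poly K} :=
  match j with
  | 0 => 1
  | 1 => 'X
  | (j''.+1 as j').+1 => 2%:R *: 'X * chebyshevT K j' - chebyshevT K j''
  end.

Definition zeta (R : realType) (h d : int) : R :=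
  cos ((2 * h - 1)%:~R * pi / (4 * d)%:~R).

(* Main.v *)
(* Both combinatorial counts equal |det M|, where M is the Laplacian of the
   sandpile grid graph restricted to doubly symmetric functions.  Indexed by
   the vertices of a quadrant, M is the Kronecker sum of A_m and A_n, where A_n
   is the path Laplacian whose last row is folded over the axis of symmetry.

   Recurrents: every class of symmetric integer vectors modulo the image of M
   contains exactly one symmetric recurrent, so their number is the order of
   the cokernel of M, read off its Smith normal form.

   Tilings: order the cells of the checkerboard lexicographically.  The sign of
   a perfect matching, seen as a permutation, is governed by the parity of its
   crossings, and these are counted, vertical edge by vertical edge, by the
   cells to the left of its lower end: the other horizontal edges fill these
   cells in pairs.  Hence the sign (-1)^column on vertical edges makes the
   weighted adjacency matrix a Kasteleyn matrix, without any planarity argument.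
   With U upper and L lower bidiagonal, U_n L_n = A_n, this matrix reads
   [[1 (x) L_n, L_m (x) 1], [U_m (x) 1, -1 (x) U_n]], and since its first two
   blocks commute its determinant is +-det M.

   Product formulas: A_n has the eigenvectors (-1)^j sin(2 j a), a = (2h-1)pi/4n,
   with eigenvalues 4 cos(a)^2, and the numbers +-cos(a) are the roots of
   T_{2n}. *)
From Stdlib Require Import Operators_Properties.
Require Import Defs.
From mathcomp Require Import perm zify ring lra mxtens.
Import GRing.Theory Num.Theory Order.TTheory.
Set Implicit Arguments.
Unset Strict Implicit.
Unset Printing Implicit Defensive.
Local Open Scope ring_scope.

(** * Signs of matchings *)

(** All ordered pairs split into the diagonal, i < j and i > j, the last transposed onto i < j. *)
Lemma prod_offdiag (R : comPzRingType) (N : nat) (F : 'I_N -> 'I_N -> R) :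
  \prod_(i < N) \prod_(j < N | (i < j)%N) (F i j * F j i) * \prod_(i < N) F i i
  = \prod_(i < N) \prod_(j < N) F i j.
Proof.
under eq_bigr do rewrite big_split.
rewrite big_split /= [X in _ * X * _](exchange_big_dep xpredT) //=.
rewrite -!big_split /=; apply: eq_bigr => i _.
rewrite [RHS](bigID (fun j : 'I_N => (i < j)%N)) /= -mulrA; congr (_ * _).
rewrite [RHS](bigD1 i) ?ltnn //= mulrC; congr (_ * _).
by apply: eq_bigl => j; rewrite -leqNgt ltn_neqAle andbC.
Qed.

(** Both sides are Vandermonde determinants, and [s] permutes the columns. *)
Lemma prod_perm_diff (N : nat) (s : 'S_N) (x : 'I_N -> int) :
  \prod_(i < N) \prod_(j < N | (i < j)%N) (x (s j) - x (s i)) =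
  (-1) ^+ s * \prod_(i < N) \prod_(j < N | (i < j)%N) (x j - x i).
Proof.
have E (y : 'I_N -> int) :
    \prod_(i < N) \prod_(j < N | (i < j)%N) (y j - y i) =
    \det (Vandermonde N (\row_i y i)).
  rewrite det_Vandermonde; apply: eq_bigr => i _.
  by apply: eq_bigr => j _; rewrite !mxE.
rewrite (E (x \o s)) E.
rewrite (_ : Vandermonde N _ = col_perm s (Vandermonde N (\row_i x i))); last first.
  by apply/matrixP => i j; rewrite !mxE.
by rewrite col_permE det_mulmx det_perm odd_permV mulrC.
Qed.

Definition ordsg (x y : nat) : int := Num.sg (y%:Z - x%:Z).

Lemma ordsgC x y : ordsg x y = - ordsg y x.
Proof. by rewrite /ordsg -opprB sgrN. Qed.

Lemma ordsgE x y : x != y -> ordsg x y = (-1) ^+ (y < x)%N.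
Proof.
rewrite /ordsg; case: (ltngtP y x) => // yx _.
  by rewrite ltr0_sg ?subr_lt0 ?ltz_nat.
by rewrite gtr0_sg ?subr_gt0 ?ltz_nat.
Qed.

Lemma ordsg_sqr x y : x != y -> ordsg x y * ordsg x y = 1.
Proof. by move=> xy; rewrite ordsgE // -expr2 sqrr_sign. Qed.

Lemma prod_perm_ordsg (N : nat) (s : 'S_N) (x : 'I_N -> nat) :
  \prod_(i < N) \prod_(j < N | (i < j)%N) ordsg (x (s i)) (x (s j)) =
  (-1) ^+ s * \prod_(i < N) \prod_(j < N | (i < j)%N) ordsg (x i) (x j).
Proof.
have E (y : 'I_N -> nat) :
    \prod_(i < N) \prod_(j < N | (i < j)%N) ordsg (y i) (y j) =
    Num.sg (\prod_(i < N) \prod_(j < N | (i < j)%N) ((y j)%:Z - (y i)%:Z)).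
  rewrite (big_morph (@Num.sg int) (@sgrM int) (sgr1 _)).
  by apply: eq_bigr => i _; rewrite (big_morph (@Num.sg int) (@sgrM int) (sgr1 _)).
rewrite (E (x \o s)) E (prod_perm_diff s (fun i => (x i)%:Z)) sgrM.
by rewrite sgrX sgrN sgr1.
Qed.

Section CrossSign.
Variables (N : nat) (b w : 'I_N -> nat).
Hypothesis b_inj : injective b.
Hypothesis w_inj : injective w.
Hypothesis bw : forall k l, b k != w l.

(** For four distinct points on a line this is -1 exactly when the chords {x, y} and {x', y'}
    cross. *)
Definition crosssg (x y x' y' : nat) : int :=
  ordsg x x' * ordsg y y' * (ordsg x y' * ordsg y x').

(** The mixed factors of all pairs of chords, together with those of the single chords, run over all
    pairs (b i, w j), so their product does not depend on [s]. The sign of [s] remains, from the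
    order of the [w] ends. *)
Lemma perm_sign_cross : exists C : int, C * C = 1 /\ forall s : 'S_N,
  (-1) ^+ s = C * (\prod_(i < N) \prod_(j < N | (i < j)%N)
                     crosssg (b i) (w (s i)) (b j) (w (s j))
              * \prod_(i < N) ordsg (b i) (w (s i))).
Proof.
pose Cb := \prod_(i < N) \prod_(j < N | (i < j)%N) ordsg (b i) (b j).
pose Cw := \prod_(i < N) \prod_(j < N | (i < j)%N) ordsg (w i) (w j).
pose Cm := \prod_(i < N) \prod_(j < N | (i < j)%N) (-1 : int).
pose Cp := \prod_(i < N) \prod_(j < N) ordsg (b i) (w j).
have sq2 (F : 'I_N -> 'I_N -> int) (P : 'I_N -> pred 'I_N) :
    (forall i j, P i j -> F i j * F i j = 1) ->
    (\prod_(i < N) \prod_(j < N | P i j) F i j) *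
    (\prod_(i < N) \prod_(j < N | P i j) F i j) = 1.
  move=> FF; rewrite -big_split big1 // => i _ /=.
  by rewrite -big_split big1 // => j /FF.
have hb : Cb * Cb = 1.
  by apply: sq2 => i j ij; apply: ordsg_sqr; rewrite (inj_eq b_inj) -val_eqE ltn_eqF.
have hw : Cw * Cw = 1.
  by apply: sq2 => i j ij; apply: ordsg_sqr; rewrite (inj_eq w_inj) -val_eqE ltn_eqF.
have hm : Cm * Cm = 1 by apply: sq2.
have hp : Cp * Cp = 1 by apply: sq2 => i j _; apply: ordsg_sqr.
exists (Cb * Cw * Cm * Cp); split.
  clearbody Cb Cw Cm Cp.
  transitivity ((Cb * Cb) * (Cw * Cw) * (Cm * Cm) * (Cp * Cp)); first by ring.
  by rewrite hb hw hm hp.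
move=> s.
pose F i j := ordsg (b i) (w (s j)).
have -> : \prod_(i < N) \prod_(j < N | (i < j)%N)
            crosssg (b i) (w (s i)) (b j) (w (s j)) =
  Cb * ((-1) ^+ s * Cw) * (Cm * \prod_(i < N) \prod_(j < N | (i < j)%N) (F i j * F j i)).
  rewrite -prod_perm_ordsg -!big_split /=; apply: eq_bigr => i _.
  rewrite -!big_split /=; apply: eq_bigr => j _.
  (* Reversing one mixed factor costs a sign per pair, collected in [Cm]. *)
  rewrite /crosssg; congr (_ * _); rewrite /F (ordsgC (w _)).
  by rewrite mulN1r mulrN.
have -> : \prod_(i < N) ordsg (b i) (w (s i)) = \prod_i F i i by [].
rewrite -!mulrA prod_offdiag.
have -> : \prod_(i < N) \prod_(j < N) F i j = Cp.
  by apply: eq_bigr => i _; rewrite [RHS](reindex_perm s).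
clearbody Cb Cw Cm Cp; move: ((-1) ^+ s) => e.
transitivity (e * (Cb * Cb) * (Cw * Cw) * (Cm * Cm) * (Cp * Cp)); last by ring.
by rewrite hb hw hm hp !mulr1.
Qed.
End CrossSign.

Definition lexlt (a b c d : nat) : bool := (a < c)%N || ((a == c) && (b < d)%N).

(** With rows growing downwards, [maxn a c] is the row of the lower end of a vertical edge, and (e,
    f) is a cell to the left of that end. *)
Definition leftbelow (a b c d e f : nat) : bool :=
  [&& b == d, e == maxn a c & f < b]%N.

Definition natadj (a b c d : nat) : bool :=
  ((a == c) && ((b.+1 == d) || (d.+1 == b)))
  || ((b == d) && ((a.+1 == c) || (c.+1 == a))).


Definition fwdadj (a b c d : nat) : bool :=
  ((a == c) && (b.+1 == d)) || ((b == d) && (a.+1 == c)).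

(** A horizontal edge joins consecutive cells, hence crosses nothing, and it puts 0 or 2 cells to
    the left of a disjoint vertical edge. Two disjoint vertical edges cross exactly when one has an
    end to the left of the lower end of the other, and this happens at most once. *)
Lemma cross_parity_fwd a b c d e f g h :
  fwdadj a b c d -> fwdadj e f g h ->
  (a != e) || (b != f) -> (a != g) || (b != h) ->
  (c != e) || (d != f) -> (c != g) || (d != h) ->
  lexlt e f a b (+) lexlt g h c d (+) (lexlt g h a b (+) lexlt e f c d) =
  leftbelow a b c d e f (+) leftbelow a b c d g h (+)
  (leftbelow e f g h a b (+) leftbelow e f g h c d).
Proof.
have mS x : maxn x x.+1 = x.+1 by apply/maxn_idPr.
have nS x : (x == x.+1) = false by lia.
have Sn x : (x.+1 == x) = false by lia.
rewrite /fwdadj.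
case/orP=> /andP[/eqP <- /eqP <-]; case/orP=> /andP[/eqP <- /eqP <-];
rewrite /lexlt /leftbelow ?mS ?maxnn ?eqxx ?nS ?Sn /= ?addbF ?addFb ?eqSS ?ltnSS.
- by case: (ltngtP a e) => ?; case: (ltngtP b f) => ? /=; lia.
- by case: (ltngtP a e) => ?; case: (ltngtP b f) => ? /=; lia.
- by case: (ltngtP a e) => ?; case: (ltngtP b f) => ? /=; lia.
- by case: (ltngtP a e) => ?; case: (ltngtP b f) => ? /=; lia.
Qed.

Lemma natadj_fwd a b c d : natadj a b c d = fwdadj a b c d || fwdadj c d a b.
Proof. by rewrite /natadj /fwdadj; lia. Qed.

Lemma natadjC a b c d : natadj a b c d = natadj c d a b.
Proof. by rewrite !natadj_fwd orbC. Qed.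

Lemma leftbelowC a b c d e f : leftbelow a b c d e f = leftbelow c d a b e f.
Proof. by rewrite /leftbelow maxnC [d == b]eq_sym; case: eqP => // ->. Qed.

(** Orienting both edges forwards only permutes the terms. *)
Lemma cross_parity a b c d e f g h :
  natadj a b c d -> natadj e f g h ->
  (a != e) || (b != f) -> (a != g) || (b != h) ->
  (c != e) || (d != f) -> (c != g) || (d != h) ->
  lexlt e f a b (+) lexlt g h c d (+) (lexlt g h a b (+) lexlt e f c d) =
  leftbelow a b c d e f (+) leftbelow a b c d g h (+)
  (leftbelow e f g h a b (+) leftbelow e f g h c d).
Proof.
rewrite !natadj_fwd => /orP[] A1 /orP[] A2 h1 h2 h3 h4.
- exact: (cross_parity_fwd A1 A2 h1 h2 h3 h4).
- have := cross_parity_fwd A1 A2 h2 h1 h4 h3; rewrite !(leftbelowC g h e f).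
  by do 4!case: (lexlt _ _ _ _); do 4!case: (leftbelow _ _ _ _ _ _).
- have := cross_parity_fwd A1 A2 h3 h4 h1 h2; rewrite !(leftbelowC c d a b).
  by do 4!case: (lexlt _ _ _ _); do 4!case: (leftbelow _ _ _ _ _ _).
- have := cross_parity_fwd A1 A2 h4 h3 h2 h1.
  rewrite !(leftbelowC c d a b) !(leftbelowC g h e f).
  by do 4!case: (lexlt _ _ _ _); do 4!case: (leftbelow _ _ _ _ _ _).
Qed.

Lemma grid_adjE p q (x y : grid p q) : grid_adj x y = natadj x.1 x.2 y.1 y.2.
Proof. by rewrite /grid_adj /natadj /coords /=; lia. Qed.

Definition pos p q (x : grid p q) : nat := (x.1 * q + x.2)%N.

Lemma pos_lt p q (x y : grid p q) : (pos x < pos y)%N = lexlt x.1 x.2 y.1 y.2.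
Proof.
rewrite /pos /lexlt; have := ltn_ord x.2; have := ltn_ord y.2.
move: (nat_of_ord x.1) (nat_of_ord y.1) (nat_of_ord x.2) (nat_of_ord y.2).
move=> a c b d dq bq; case: (ltngtP a c) => [ac|ca|->] /=.
- by apply: leq_trans (_ : a.+1 * q <= _)%N; [rewrite mulSn addnC ltn_add2r|
    apply: leq_trans (leq_addr _ _); rewrite leq_mul2r ac orbT].
- apply/negbTE; rewrite -leqNgt; apply: ltnW.
  by apply: leq_trans (_ : c.+1 * q <= _)%N; [rewrite mulSn addnC ltn_add2r|
    apply: leq_trans (leq_addr _ _); rewrite leq_mul2r ca orbT].
- by rewrite ltn_add2l.
Qed.

Lemma pos_inj p q : injective (@pos p q).
Proof.
move=> x y xy; have := pos_lt x y; have := pos_lt y x; rewrite xy ltnn /lexlt.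
move=> h1 h2; case: x y h1 h2 {xy} => [a b] [c d] /= h1 h2.
by congr pair; apply: val_inj => /=; lia.
Qed.

Lemma grid_neqE p q (x y : grid p q) :
  (x != y) = (nat_of_ord x.1 != y.1) || (nat_of_ord x.2 != y.2).
Proof. by rewrite -negb_and. Qed.

(** The first factor cancels the factor of a single chord in [perm_sign_cross]; the second is
    (-1)^column on vertical edges. *)
Definition kast p q (x y : grid p q) : int :=
  (-1) ^+ (pos y < pos x)%N * (-1) ^+ ((x.2 == y.2) * x.2)%N.

Section MatchingSign.
Variables (p q N : nat) (b w : 'I_N -> grid p q).
Hypothesis b_inj : injective b.
Hypothesis w_inj : injective w.
Hypothesis bw : forall k l, b k != w l.
Hypothesis bw_cover : forall x, (x \in codom b) || (x \in codom w).

Lemma sum_codom2 (F : grid p q -> nat) :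
  (\sum_k F (b k) + \sum_k F (w k) = \sum_x F x)%N.
Proof.
have im (f : 'I_N -> grid p q) : injective f ->
    (\sum_k F (f k) = \sum_(x in codom f) F x)%N.
  move=> fi; transitivity (\sum_(x in [set f k | k in [set: 'I_N]]) F x)%N.
    by rewrite big_imset /= => [|? ? _ _ /fi //]; apply: eq_bigl => k; rewrite inE.
  by apply: eq_bigl => x; apply/imsetP/codomP => [[k _ ->]|[k ->]]; exists k.
rewrite !im // [RHS](bigID (mem (codom b))) /=; congr (_ + _)%N.
apply: eq_bigl => x; have := bw_cover x; case: (boolP (x \in codom b)) => //=.
by case/codomP=> k -> _; apply/negbTE/negP => /codomP[l] /eqP; rewrite (negbTE (bw k l)).
Qed.

Lemma sum_left_cells (r : 'I_p) (c : 'I_q) :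
  (\sum_(x : grid p q) ((x.1 == r) && (x.2 < c)) = c)%N.
Proof.
rewrite -(pair_bigA _ (fun (i : 'I_p) (j : 'I_q) => nat_of_bool ((i == r) && (j < c)%N))) /=.
rewrite (bigD1 r) //= [X in (_ + X)%N]big1 => [|i /negbTE -> /=]; last first.
  by rewrite big1.
rewrite addn0 eqxx /= (eq_bigr (fun j : 'I_q => if (j < c)%N then 1%N else 0%N)).
  rewrite -big_mkcond /= -(big_ord_widen _ (fun=> 1%N)) ?sum1_card ?card_ord //.
  exact: ltnW.
by move=> j _; case: ltnP.
Qed.

(** Over all pairs of dominoes, the crossing parities add up to the cells left of the lower end of
    each vertical domino. As the dominoes cover the grid, their number is the 0-based column. *)
Lemma matching_sign : exists C : int, C * C = 1 /\ forall s : 'S_N,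
  (forall k, grid_adj (b k) (w (s k))) ->
  (-1) ^+ s * \prod_k kast (b k) (w (s k)) = C.
Proof.
have pbi : injective (fun k => pos (b k)) by move=> k l /pos_inj/b_inj.
have pwi : injective (fun k => pos (w k)) by move=> k l /pos_inj/w_inj.
have pbw k l : pos (b k) != pos (w l) by rewrite (inj_eq (@pos_inj p q)).
have [C [CC H]] := perm_sign_cross pbi pwi pbw.
exists C; split=> // s adj.
pose lb i (x : grid p q) := leftbelow (b i).1 (b i).2 (w (s i)).1 (w (s i)).2 x.1 x.2.
(* The parity of the number of ends of domino j to the left of the lower end of domino i. Since
   [G i i] is 1, the pairs i < j may be completed to all (i, j). *)
pose G i j : int := (-1) ^+ (lb i (b j) + lb i (w (s j)))%N.
have Gii i : G i i = 1.
  rewrite /G /lb /leftbelow ltnn !andbF; case: eqP => //= ->.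
  by rewrite ltnn andbF.
rewrite H.
have -> : \prod_(i < N) \prod_(j < N | (i < j)%N)
  crosssg (pos (b i)) (pos (w (s i))) (pos (b j)) (pos (w (s j))) =
  \prod_(i < N) \prod_(j < N | (i < j)%N) (G i j * G j i).
  apply: eq_bigr => i _; apply: eq_bigr => j ij.
  have nij : i != j by rewrite -val_eqE ltn_eqF.
  have nsij : s i != s j by rewrite (inj_eq perm_inj).
  rewrite /crosssg !ordsgE ?(inj_eq pbi) ?(inj_eq pwi) //; last by rewrite eq_sym.
  rewrite -!signr_addb /G !exprD -!signr_addb !pos_lt; congr ((-1) ^+ nat_of_bool _).
  apply: cross_parity; rewrite -?grid_adjE -?grid_neqE ?adj //.
  - by rewrite (inj_eq b_inj).
  - by rewrite eq_sym bw.
  - by rewrite (inj_eq w_inj).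
have -> : \prod_(i < N) \prod_(j < N | (i < j)%N) (G i j * G j i) =
   \prod_i ((-1) ^+ (((b i).2 == (w (s i)).2) * (b i).2)%N).
  have := prod_offdiag G; rewrite [X in _ * X]big1 // mulr1 => ->.
  apply: eq_bigr => i _; rewrite /G prodrXr big_split /=; congr (_ ^+ _).
  rewrite [X in (_ + X)%N](_ : _ = \sum_j lb i (w j))%N; last first.
    by rewrite [RHS](reindex_perm s).
  rewrite (sum_codom2 (fun x => lb i x)) /lb /leftbelow.
  rewrite -[(b i).2 == _]val_eqE /=; case: eqP => /= [bwi|_]; last by rewrite big1.
  rewrite mul1n.
  have [r rE] : exists r : 'I_p, maxn (b i).1 (w (s i)).1 = r.
    by case: (leqP (b i).1 (w (s i)).1) => ?; [exists (w (s i)).1 | exists (b i).1].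
  by rewrite rE (sum_left_cells r).
have -> : \prod_(i < N) ordsg (pos (b i)) (pos (w (s i))) =
          \prod_(i < N) (-1) ^+ (pos (w (s i)) < pos (b i))%N.
  by apply: eq_bigr => i _; rewrite ordsgE.
rewrite -mulrA -big_split /= /kast -big_split /= big1 ?mulr1 // => i _.
rewrite [X in X * _]mulrC -expr2 exprMn -!exprM !muln2 -!mul2n !exprM.
by rewrite sqrrN expr1n !expr1n mulr1.
Qed.
End MatchingSign.

(** * Weighted matchings as a determinant *)

Lemma grid_adjC p q (x y : grid p q) : grid_adj x y = grid_adj y x.
Proof. by rewrite !grid_adjE natadjC. Qed.

Section MatchingPerm.
Variables (p q N : nat) (b w : 'I_N -> grid p q).
Hypothesis b_inj : injective b.
Hypothesis w_inj : injective w.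
Hypothesis bw : forall k l, b k != w l.
Hypothesis bw_cover : forall x, (x \in codom b) || (x \in codom w).
Hypothesis adj_bw : forall x y, grid_adj x y -> (x \in codom b) = (y \in codom w).

Definition edge_set (s : 'S_N) : {set {set grid p q}} :=
  [set [set b k; w (s k)]%SET | k in [set: 'I_N]]%SET.

Definition admissible (s : 'S_N) : bool :=
  [forall k, grid_adj (b k) (w (s k))].

Lemma edge_bw_inj k l k' l' :
  [set b k; w l]%SET = [set b k'; w l']%SET -> k = k' /\ l = l'.
Proof.
move=> E; have /setP/(_ (b k)) := E; have /setP/(_ (w l)) := E.
rewrite !inE !eqxx orbT /= [w l == b k']eq_sym (negbTE (bw _ _)) (negbTE (bw k l')).
by rewrite orbF /= (inj_eq b_inj) (inj_eq w_inj) => /esym/eqP -> /esym/eqP ->.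
Qed.

Lemma edge_set_inj : injective edge_set.
Proof.
move=> s t E; apply/permP => k.
have : [set b k; w (s k)]%SET \in edge_set t by rewrite -E; apply: imset_f; rewrite inE.
by case/imsetP => l _ /edge_bw_inj[-> ->].
Qed.

Lemma edge_set_matching s : admissible s -> perfect_matching (edge_set s).
Proof.
move/forallP=> adm; apply/andP; split.
  apply/fintype.subsetP => _ /imsetP[k _ ->]; rewrite inE; apply/existsP; exists (b k).
  by apply/existsP; exists (w (s k)); rewrite adm eqxx.
apply/forallP => v.
have [k kE] : exists k, [set e in edge_set s | v \in e]%SET = [set [set b k; w (s k)]]%SET.
  have /orP[/codomP[k ->]|/codomP[l ->]] := bw_cover v.
    exists k; apply/setP => e; rewrite !inE; apply/andP/eqP => [[/imsetP[k' _ ->]]|->].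
      by rewrite !inE (negbTE (bw _ _)) orbF (inj_eq b_inj) => /eqP ->.
    by rewrite !inE eqxx; split=> //; apply: imset_f; rewrite inE.
  exists (s^-1 l)%g; apply/setP => e; rewrite !inE permKV.
  apply/andP/eqP => [[/imsetP[k' _ ->]]|->].
    by rewrite !inE eq_sym (negbTE (bw _ _)) (inj_eq w_inj) => /eqP ->; rewrite permK.
  rewrite !inE eqxx orbT; split=> //; apply/imsetP; exists (s^-1 l)%g; rewrite ?inE //.
  by rewrite permKV.
by rewrite kE cards1.
Qed.

(** Each [b] cell has one partner, and distinct [b] cells have distinct partners because a [w] cell
    lies on one edge only. *)
Lemma matching_edge_set M : perfect_matching M ->
  exists2 s, admissible s & M = edge_set s.
Proof.
case/andP=> /fintype.subsetP sub /forallP one.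
have uniq_edge v e e' : e \in M -> e' \in M -> v \in e -> v \in e' -> e = e'.
  move=> eM e'M ve ve'; have /cards1P[e0 E0] := one v.
  have : e \in [set e in M | v \in e]%SET by rewrite inE eM.
  have : e' \in [set e in M | v \in e]%SET by rewrite inE e'M.
  by rewrite E0 !inE => /eqP -> /eqP ->.
have edgeP e : e \in M -> exists k l, e = [set b k; w l]%SET /\ grid_adj (b k) (w l).
  move/sub; rewrite inE => /existsP[x /existsP[y /andP[xy /eqP ->]]].
  have := adj_bw xy; case: (boolP (x \in codom b)) => [/codomP[k xk] /esym/codomP[l yl]|].
    by exists k, l; rewrite -xk -yl.
  move=> xNb; have := bw_cover x; rewrite (negbTE xNb) /= => /codomP[l xl] _.
  have := xy; rewrite grid_adjC => /adj_bw; rewrite {1}xl codom_f => /codomP[k yk].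
  by exists k, l; rewrite -xl -yk finset.setUC grid_adjC.
have /fin_all_exists[f fP] k : exists l, [set b k; w l]%SET \in M /\ grid_adj (b k) (w l).
  have /cards1P[e0 E0] := one (b k).
  have : e0 \in [set e in M | b k \in e]%SET by rewrite E0 inE.
  rewrite inE => /andP[e0M]; have [k' [l [e0E adj]]] := edgeP _ e0M.
  rewrite e0E !inE (negbTE (bw _ _)) orbF (inj_eq b_inj) => /eqP ->.
  by exists l; rewrite -e0E.
have f_inj : injective f.
  move=> k k' ff; have := uniq_edge (w (f k)) _ _ (fP k).1 (fP k').1.
  by rewrite !inE ff eqxx !orbT => /(_ isT isT)/edge_bw_inj[].
exists (perm f_inj); first by apply/forallP => k; rewrite permE; case: (fP k).
apply/setP => e; apply/idP/imsetP => [eM|[k _ ->]]; last first.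
  by rewrite permE; case: (fP k).
have [k [l [eE _]]] := edgeP _ eM; exists k => //; rewrite permE.
by apply: (uniq_edge (b k) _ _ eM (fP k).1); rewrite ?eE !inE eqxx.
Qed.

Lemma sum_matchings (wt : {set grid p q} -> nat) :
  (\sum_(M | perfect_matching M) \prod_(e in M) wt e =
   \sum_(s : 'S_N | admissible s) \prod_k wt [set b k; w (s k)]%SET)%N.
Proof.
transitivity (\sum_(M in [set edge_set s | s in [pred s | admissible s]]%SET)
   \prod_(e in M) wt e)%N.
  apply: eq_bigl => M; apply/idP/imsetP => [/matching_edge_set[s ? ->]|[s adm ->]].
    by exists s.
  exact: edge_set_matching.
rewrite big_imset /=; last by move=> s t _ _; apply: edge_set_inj.
apply: eq_bigr => s _; rewrite big_imset /=; last by move=> k l _ _ /edge_bw_inj[].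
by apply: eq_bigl => k; rewrite inE.
Qed.

(* Both sides of the bipartition are enumerated in an arbitrary order, which
   costs the global sign [C]. *)
Lemma sum_matchings_det (wt : {set grid p q} -> nat) :
  exists2 C : int, C * C = 1 &
  (\sum_(M : {set {set grid p q}} | perfect_matching M) \prod_(e in M) wt e)%N%:Z =
  C * \det (\matrix_(k, l) (if grid_adj (b k) (w l)
         then kast (b k) (w l) * (wt [set b k; w l]%SET)%:Z else 0)).
Proof.
have [C [CC H]] := matching_sign b_inj w_inj bw bw_cover.
exists C => //; rewrite sum_matchings /determinant mulr_sumr.
rewrite [RHS](bigID admissible) /= [X in _ + X]big1 => [|s]; last first.
  rewrite negb_forall => /existsP[k kN]; rewrite (bigD1 k) //= mxE (negbTE kN).
  by rewrite mul0r !mulr0.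
rewrite addr0 (big_morph Posz PoszD (erefl _)); apply: eq_bigr => s adm.
rewrite (eq_bigr (fun k => kast (b k) (w (s k)) * (wt [set b k; w (s k)]%SET)%:Z)); last first.
  by move=> k _; rewrite mxE (forallP adm).
rewrite big_split /= !mulrA -(mulrA C) (H s) ?CC ?mul1r; last exact/forallP.
by rewrite (big_morph Posz PoszM (erefl _)).
Qed.
End MatchingPerm.

(** * The Kasteleyn matrix of the 2-weighted checkerboard *)

Definition special_edge m n (x y : grid (2 * m) (2 * n)) : bool :=
  (odd x.1 && (x.1 == y.1 :> nat) &&
     (((x.2.+2 == 2 * n) && (y.2.+1 == 2 * n)) || ((y.2.+2 == 2 * n) && (x.2.+1 == 2 * n))))%N
  || (odd x.2 && (x.2 == y.2 :> nat) &&
     (((x.1.+2 == 2 * m) && (y.1.+1 == 2 * m)) || ((y.1.+2 == 2 * m) && (x.1.+1 == 2 * m))))%N.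

(** [special_edge] lists the edges of weight 2 in 0-based coordinates, where the even rows and
    columns become odd. *)
Lemma edge_weightE m n (x y : grid (2 * m) (2 * n)) : x != y ->
  edge_weight [set x; y]%SET = if special_edge x y then 2%N else 1%N.
Proof.
move=> xy; rewrite /edge_weight; congr (if _ then _ else _).
have Egrid (z t : grid (2 * m) (2 * n)) :
    (z == t) = (z.1 == t.1 :> nat) && (z.2 == t.2 :> nat) by [].
have Ein (z : grid (2 * m) (2 * n)) X Y :
   (z \in edge_at _ _ X Y) =
   ((z.1.+1 == X.1) && (z.2.+1 == X.2)) || ((z.1.+1 == Y.1) && (z.2.+1 == Y.2)).
  by rewrite !inE.
have xin : x \in [set x; y]%SET by rewrite !inE eqxx.
have yin : y \in [set x; y]%SET by rewrite !inE eqxx orbT.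
rewrite Egrid in xy; have x1 := ltn_ord x.1; have x2 := ltn_ord x.2.
have y1 := ltn_ord y.1; have y2 := ltn_ord y.2.
congr (_ || _).
  apply/existsP/idP => [[h /eqP E]|H].
    move: xin yin (ltn_ord h); rewrite E !Ein /=; move: xy x1 x2 y1 y2.
    move: (nat_of_ord h)
    (nat_of_ord x.1) (nat_of_ord x.2) (nat_of_ord y.1) (nat_of_ord y.2) => h' a b c d.
    move=> xy a2 b2 c2 d2 X Y hm.
    by apply/andP; split; first (apply/andP; split); lia.
  (* This h solves x.1 + 1 = 2m - 2h. *)
  have hlt : (m - x.1.+1 %/ 2 < m)%N by lia.
  exists (Ordinal hlt); apply/eqP/setP => z; rewrite Ein !inE !Egrid /=.
  move: (ltn_ord z.1) (ltn_ord z.2) H xy x1 x2 y1 y2 {hlt}.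
  move: (nat_of_ord z.1) (nat_of_ord z.2)
    (nat_of_ord x.1) (nat_of_ord x.2) (nat_of_ord y.1) (nat_of_ord y.2) => z1 z2 a b c d.
  move=> ? ? /andP[/andP[od /eqP e] H] xy a2 b2 c2 d2.
  by case/orP: H => /andP[/eqP ? /eqP ?]; apply/idP/idP => /orP[]/andP[/eqP ? /eqP ?]; lia.
apply/existsP/idP => [[h /eqP E]|H].
  move: xin yin (ltn_ord h); rewrite E !Ein /=; move: xy x1 x2 y1 y2.
  move: (nat_of_ord h) (nat_of_ord x.1) (nat_of_ord x.2)
    (nat_of_ord y.1) (nat_of_ord y.2) => h' a b c d.
  move=> xy a2 b2 c2 d2 X Y hm.
  by apply/andP; split; first (apply/andP; split); lia.
have hlt : (n - x.2.+1 %/ 2 < n)%N by lia.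
exists (Ordinal hlt); apply/eqP/setP => z; rewrite Ein !inE !Egrid /=.
move: (ltn_ord z.1) (ltn_ord z.2) H xy x1 x2 y1 y2 {hlt}.
move: (nat_of_ord z.1) (nat_of_ord z.2)
    (nat_of_ord x.1) (nat_of_ord x.2) (nat_of_ord y.1) (nat_of_ord y.2) => z1 z2 a b c d.
move=> ? ? /andP[/andP[od /eqP e] H] xy a2 b2 c2 d2.
by case/orP: H => /andP[/eqP ? /eqP ?]; apply/idP/idP => /orP[]/andP[/eqP ? /eqP ?]; lia.
Qed.

Definition kentry m n (x y : grid (2 * m) (2 * n)) : int :=
  if grid_adj x y then kast x y * (edge_weight [set x; y]%SET)%:Z else 0.

Lemma kentryE m n (x y : grid (2 * m) (2 * n)) (adj neg dbl : bool) :
  natadj x.1 x.2 y.1 y.2 = adj ->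
  (adj -> lexlt y.1 y.2 x.1 x.2 (+) ((x.2 == y.2 :> nat) && odd x.2) = neg) ->
  (adj -> special_edge x y = dbl) ->
  kentry x y = if adj then (-1) ^+ neg * (if dbl then 2 else 1) else 0.
Proof.
rewrite /kentry grid_adjE => Ha; rewrite Ha; case: adj Ha => // Ha Hn Hd.
have xy : x != y by apply/eqP => E; move: Ha; rewrite E /natadj; lia.
rewrite edge_weightE // Hd // /kast pos_lt -val_eqE -(Hn isT) signr_addb.
congr (_ * _ * _); first by rewrite -signr_odd oddM oddb.
by case: (dbl).
Qed.

Definition dbl_ord m (e : bool) (a : 'I_m) : 'I_(2 * m).
Proof. by exists (2 * a + e)%N; case: a => a /=; case: e; lia. Defined.

(** The grid splits into four parity classes, each a copy of [m] x [n]. *)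
Definition cell m n (e f : bool) (ab : 'I_m * 'I_n) : grid (2 * m) (2 * n) :=
  (dbl_ord e ab.1, dbl_ord f ab.2).

Lemma cell_inj m n e f e' f' (u v : 'I_m * 'I_n) :
  cell e f u = cell e' f' v -> [/\ e = e', f = f' & u = v].
Proof.
case: u v => [a b] [c d] [E1 E2].
have ee : e = e' by move: E1 {E2}; case: e; case: e' => //; lia.
have ff : f = f' by move: E2 {E1}; case: f; case: f' => //; lia.
split=> //; congr pair; apply: val_inj => /=; move: E1 E2; rewrite ee ff; lia.
Qed.

Lemma cell_surj m n (x : grid (2 * m) (2 * n)) : exists u, x = cell (odd x.1) (odd x.2) u.
Proof.
case: x => [[i im] [j jn]] /=.
have hi : (i./2 < m)%N by lia.
have hj : (j./2 < n)%N by lia.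
exists (Ordinal hi, Ordinal hj); congr pair; apply: val_inj => /=; lia.
Qed.

(** Each colour is listed class by class, in the index order of the Kronecker product, so that the
    Kasteleyn matrix has four tensor blocks. *)
Definition bcell m n (k : 'I_(m * n + m * n)) : grid (2 * m) (2 * n) :=
  match fintype.split k with
  | inl i => cell false false (mxtens_unindex i)
  | inr i => cell true true (mxtens_unindex i)
  end.

Definition wcell m n (k : 'I_(m * n + m * n)) : grid (2 * m) (2 * n) :=
  match fintype.split k with
  | inl i => cell false true (mxtens_unindex i)
  | inr i => cell true false (mxtens_unindex i)
  end.

Lemma bcell_inj m n : injective (@bcell m n).
Proof.
move=> k l; rewrite /bcell => E; apply: (can_inj (@splitK _ _)); move: E.
case: (fintype.split k) => i; case: (fintype.split l) => j /cell_inj[] // _ _;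
  by move/(can_inj (@mxtens_unindexK m n)) => ->.
Qed.

Lemma wcell_inj m n : injective (@wcell m n).
Proof.
move=> k l; rewrite /wcell => E; apply: (can_inj (@splitK _ _)); move: E.
case: (fintype.split k) => i; case: (fintype.split l) => j /cell_inj[] // _ _;
  by move/(can_inj (@mxtens_unindexK m n)) => ->.
Qed.

Lemma mem_bcell m n (x : grid (2 * m) (2 * n)) :
  (x \in codom (@bcell m n)) = (odd x.1 == odd x.2).
Proof.
apply/codomP/eqP => [[k ->]|oo].
  by rewrite /bcell; case: (fintype.split k) => i; rewrite /cell /=; lia.
have [u] := cell_surj x; rewrite oo => ->; case: (odd x.2).
  exists (rshift _ (mxtens_index u)).
  by rewrite /bcell (unsplitK (inr _)) mxtens_indexK.
exists (lshift _ (mxtens_index u)).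
by rewrite /bcell (unsplitK (inl _)) mxtens_indexK.
Qed.

Lemma mem_wcell m n (x : grid (2 * m) (2 * n)) :
  (x \in codom (@wcell m n)) = (odd x.1 != odd x.2).
Proof.
apply/codomP/idP => [[k ->]|oo].
  by rewrite /wcell; case: (fintype.split k) => i; rewrite /cell /=; lia.
have [u] := cell_surj x; move: oo; case: (odd x.1); case: (odd x.2) => // _ ->.
  exists (rshift _ (mxtens_index u)).
  by rewrite /wcell (unsplitK (inr _)) mxtens_indexK.
exists (lshift _ (mxtens_index u)).
by rewrite /wcell (unsplitK (inl _)) mxtens_indexK.
Qed.

Lemma bcell_neq_wcell m n k l : @bcell m n k != @wcell m n l.
Proof.
have := codom_f (@bcell m n) k; have := codom_f (@wcell m n) l.
by rewrite mem_bcell mem_wcell => h1 h2; apply: contra h1 => /eqP <-.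
Qed.

Lemma bcell_wcell_cover m n x : (x \in codom (@bcell m n)) || (x \in codom (@wcell m n)).
Proof. by rewrite mem_bcell mem_wcell orbN. Qed.

Lemma adj_bcell_wcell m n x y : grid_adj x y ->
  (x \in codom (@bcell m n)) = (y \in codom (@wcell m n)).
Proof.
rewrite grid_adjE mem_bcell mem_wcell /natadj.
move: (nat_of_ord x.1) (nat_of_ord x.2) (nat_of_ord y.1) (nat_of_ord y.2).
move=> a b c d /orP[]/andP[/eqP -> /orP[]/eqP <-] /=; lia.
Qed.

(** * Block form and determinant of the Kasteleyn matrix *)

Definition lowL n : 'M[int]_n := \matrix_(i, j) ((i == j)%:R - (i == j.+1 :> nat)%:R).

Definition uppU n : 'M[int]_n :=
  \matrix_(i, j) ((i == j)%:R *+ (if i.+1 == n then 2 else 1) - (i.+1 == j :> nat)%:R).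

(** An edge changes the parity of one coordinate and fixes the other, whence the identity factors.
    On odd columns the column sign makes the diagonal of [uppU m] positive; the edges of weight 2
    double the last diagonal entry of [uppU]. *)
Lemma kasteleyn_block m n :
  \matrix_(k, l) kentry (@bcell m n k) (wcell l) =
  block_mx (1%:M *t lowL n) (lowL m *t 1%:M) (uppU m *t 1%:M) (- (1%:M *t uppU n)).
Proof.
rewrite -[LHS]submxK; congr block_mx; apply/matrixP => i j.
- case: (mxtens_indexP i) => a b; case: (mxtens_indexP j) => c d.
  have := ltn_ord a; have := ltn_ord b; have := ltn_ord c; have := ltn_ord d.
  move=> dn cm bn am.
  rewrite tensmxE !mxE /bcell /wcell ?(unsplitK (inl _)) ?(unsplitK (inr _)) !mxtens_indexK.
  rewrite (@kentryE _ _ _ _ ((a == c) && ((b == d) || (b == d.+1 :> nat)))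
    (b == d.+1 :> nat) false);
   rewrite ?/natadj ?/lexlt ?/special_edge -?val_eqE /=; try lia.
  by do 4?[case: eqP => ?] => //=; lia.
- case: (mxtens_indexP i) => a b; case: (mxtens_indexP j) => c d.
  have := ltn_ord a; have := ltn_ord b; have := ltn_ord c; have := ltn_ord d.
  move=> dn cm bn am.
  rewrite tensmxE !mxE /bcell /wcell ?(unsplitK (inl _)) ?(unsplitK (inr _)) !mxtens_indexK.
  rewrite (@kentryE _ _ _ _ ((b == d) && ((a == c) || (a == c.+1 :> nat)))
    (a == c.+1 :> nat) false);
   rewrite ?/natadj ?/lexlt ?/special_edge -?val_eqE /=; try lia.
  by do 4?[case: eqP => ?] => //=; lia.
- case: (mxtens_indexP i) => a b; case: (mxtens_indexP j) => c d.
  have := ltn_ord a; have := ltn_ord b; have := ltn_ord c; have := ltn_ord d.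
  move=> dn cm bn am.
  rewrite tensmxE !mxE /bcell /wcell ?(unsplitK (inl _)) ?(unsplitK (inr _)) !mxtens_indexK.
  rewrite (@kentryE _ _ _ _ ((b == d) && ((a == c) || (a.+1 == c :> nat)))
    (a.+1 == c :> nat) ((a == c) && (a.+1 == m)));
   rewrite ?/natadj ?/lexlt ?/special_edge -?val_eqE /=; try lia.
  by do 4?[case: eqP => ?] => //=; lia.
- case: (mxtens_indexP i) => a b; case: (mxtens_indexP j) => c d.
  have := ltn_ord a; have := ltn_ord b; have := ltn_ord c; have := ltn_ord d.
  move=> dn cm bn am.
  rewrite [RHS]mxE tensmxE !mxE /bcell /wcell.
  rewrite ?(unsplitK (inl _)) ?(unsplitK (inr _)) !mxtens_indexK.
  rewrite (@kentryE _ _ _ _ ((a == c) && ((b == d) || (b.+1 == d :> nat)))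
    (b == d) ((b == d) && (b.+1 == n)));
   rewrite ?/natadj ?/lexlt ?/special_edge -?val_eqE /=; try lia.
  by do 4?[case: eqP => ?] => //=; lia.
Qed.

(** Right multiplication by [[1, -Y], [0, X]] clears the upper right block; the factor det X is then
    cancelled. *)
Lemma det_block_comm (R : idomainType) N (X Y Z T : 'M[R]_N) :
  X *m Y = Y *m X -> \det X != 0 ->
  \det (block_mx X Y Z T) = \det (T *m X - Z *m Y).
Proof.
move=> XY X0; apply: (mulIf X0).
have -> : \det (block_mx X Y Z T) * \det X =
          \det (block_mx X Y Z T *m block_mx 1%:M (- Y) 0 X).
  by rewrite det_mulmx det_ublock det1 mul1r.
rewrite mulmx_block !mulmx1 !mulmx0 !mulmxN !addr0 XY addNr det_lblock mulrC.
by rewrite addrC.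
Qed.

Lemma tensmx11 (R : comPzRingType) m n : (1%:M *t 1%:M : 'M[R]_(m * n)) = 1%:M.
Proof.
apply/matrixP => i j; case: (mxtens_indexP i) => a b; case: (mxtens_indexP j) => c d.
rewrite tensmxE !mxE (inj_eq (can_inj (@mxtens_indexK m n))) xpair_eqE.
by case: eqP; case: eqP; rewrite ?mulr1 ?mulr0.
Qed.

Definition fold_lap n : 'M[int]_n :=
  \matrix_(i, j) ((i == j)%:R *+ 2 - (i.+1 == j :> nat)%:R
                  - (i == j.+1 :> nat)%:R *+ (if i.+1 == n then 2 else 1)).

Definition fold_lap2 m n : 'M[int]_(m * n) :=
  fold_lap m *t 1%:M + 1%:M *t fold_lap n.

Lemma uppU_lowL n : uppU n *m lowL n = fold_lap n.
Proof.
apply/matrixP => i j; rewrite !mxE.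
under eq_bigr do rewrite !mxE mulrBl.
rewrite sumrB (bigD1 i) //= eqxx [X in _ + X - _]big1 => [|k /negbTE]; last first.
  by rewrite eq_sym => ->; rewrite mul0rn mul0r.
have jn := ltn_ord j; have iN := ltn_ord i.
have [i1n|i1n] := ltnP i.+1 n.
  rewrite (bigD1 (Ordinal i1n)) //= eqxx big1 => [|k]; last first.
    by rewrite -val_eqE /= eq_sym => /negbTE ->; rewrite mul0r.
  rewrite -!val_eqE /= eqSS.
  by do 4?[case: eqP => ?] => //=; lia.
rewrite [X in _ - X]big1 => [|k _]; last first.
  by case: eqP => [E|]; rewrite ?mul0r //; have := ltn_ord k; lia.
rewrite -!val_eqE /=.
by do 4?[case: eqP => ?] => //=; lia.
Qed.

Lemma det_lowL n : \det (lowL n) = 1.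
Proof.
rewrite det_trig; last first.
  apply/is_trig_mxP => i j ij; rewrite mxE -val_eqE /=.
  by case: eqP => ?; case: eqP => ?; lia.
by rewrite big1 // => i _; rewrite mxE eqxx; case: eqP => //; lia.
Qed.

Lemma det_kasteleyn m n : exists2 C : int, C * C = 1 &
  \det (\matrix_(k, l) kentry (@bcell m n k) (wcell l)) = C * \det (fold_lap2 m n).
Proof.
exists ((-1) ^+ (m * n)); first by rewrite -expr2 sqrr_sign.
rewrite kasteleyn_block det_block_comm.
- rewrite mulNmx !tensmx_mul !mulmx1 !uppU_lowL -opprD addrC -scaleN1r detZ.
  by rewrite /fold_lap2.
- by rewrite !tensmx_mul !mulmx1 !mul1mx.
(* As det L = 1, the tensor product of 1 with the adjugate of L is an inverse. *)
- apply/eqP => d0; have := congr1 determinant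
    (@tensmx_mul int _ _ _ _ _ _ (1%:M : 'M[int]_m) (lowL n) 1%:M (adjugate (lowL n))).
  by rewrite mulmx1 mul_mx_adj det_lowL tensmx11 det1 det_mulmx d0 mul0r.
Qed.

Lemma weighted_domino_tilings_det m n :
  weighted_domino_tilings m n = `|\det (fold_lap2 m n)|%N.
Proof.
have [C CC E] := sum_matchings_det (@bcell_inj m n) (@wcell_inj m n)
  (@bcell_neq_wcell m n) (@bcell_wcell_cover m n) (@adj_bcell_wcell m n) (@edge_weight m n).
have [D DD F] := det_kasteleyn m n.
have n1 (x : int) : x * x = 1 -> `|x|%N = 1%N.
  by move/(congr1 absz); rewrite abszM => /eqP; rewrite muln_eq1 => /andP[/eqP].
have := congr1 absz E; rewrite -/(weighted_domino_tilings m n) /= => ->.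
by rewrite abszM n1 // mul1n -[in LHS]/(kentry _ _) F abszM n1 // mul1n.
Qed.

(** * Eigenvalues of the folded Laplacian *)

Lemma sum_delta (R : pzRingType) n (j : nat) (g : nat -> R) :
  \sum_(k < n) (j == k :> nat)%:R * g k = if (j < n)%N then g j else 0.
Proof.
case: ifP => jn.
  rewrite (bigD1 (Ordinal jn)) //= eqxx mul1r big1 ?addr0 // => k.
  by rewrite -val_eqE /= eq_sym => /negbTE ->; rewrite mul0r.
by rewrite big1 // => k _; case: eqP => [E|_]; rewrite ?mul0r //; have := ltn_ord k; lia.
Qed.

(* [f 0 = 0] is the sink boundary and [f n.+1 = f n.-1] the reflection in the
   axis of symmetry. *)
Lemma fold_lap_sum (R : pzRingType) n (f : nat -> R) (i : 'I_n) :
  f 0%N = 0 -> f n.+1 = f n.-1 ->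
  \sum_(k < n) (fold_lap n i k)%:~R * f k.+1 = f i.+1 *+ 2 - f i - f i.+2.
Proof.
move=> f0 fn.
transitivity (\sum_(k < n) ((i == k :> nat)%:R * f k.+1) *+ 2
  - \sum_(k < n) ((i.+1 == k :> nat)%:R * f k.+1)
  - (\sum_(k < n) ((i == k.+1 :> nat)%:R * f k.+1)) *+ (if i.+1 == n then 2 else 1)).
  rewrite -sumrMnl -!sumrB; apply: eq_bigr => k _; rewrite mxE !rmorphB !rmorphMn !rmorph1.
  by rewrite !mulrBl !mulrnAl -val_eqE.
have S j : \sum_(k < n) (j == k :> nat)%:R * f k.+1 = if (j < n)%N then f j.+1 else 0.
  exact: (sum_delta n j (fun k => f k.+1)).
rewrite sumrMnl !S ltn_ord.
have -> : \sum_(k < n) ((i == k.+1 :> nat)%:R * f k.+1) = f i.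
  have := ltn_ord i; case: (nat_of_ord i) => [|j] jn.
    by rewrite f0 big1 // => k _; rewrite mul0r.
  under eq_bigr do rewrite eqSS.
  by rewrite S ltnW.
have := ltn_ord i; have [E|i1n] := eqVneq i.+1 n => iN.
  have -> : f i.+2 = f i by rewrite E fn; congr f; rewrite -[i : nat]/(i.+1.-1) E.
  by rewrite E ltnn subr0 mulr2n opprD addrA.
by rewrite ltn_neqAle i1n iN addrAC.
Qed.

Section Eigen.
Variable R : realType.

(** The angle of [zeta], with h counted from 0. *)
Definition ang (d h : nat) : R := (2 * h + 1)%:R * pi / (4 * d)%:R.

Lemma zetaE (d h : nat) : zeta R h.+1 d = cos (ang d h).
Proof.
rewrite /zeta /ang; congr (cos (_ * _ / _)).
by rewrite (_ : (2 * h.+1%:Z - 1) = (2 * h + 1)%N%:Z) //; lia.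
Qed.

Lemma ang_itv d h : (h < d)%N -> 0 < ang d h < pi / 2.
Proof.
move=> hd; have pi0 := pi_gt0 R; have d0 : (0 : R) < (4 * d)%:R by rewrite ltr0n; lia.
rewrite /ang; apply/andP; split.
  by apply: divr_gt0 => //; apply: mulr_gt0 => //; rewrite ltr0n; lia.
rewrite ltr_pdivrMr //.
have -> : pi / 2 * (4 * d)%:R = (2 * d)%:R * pi :> R by rewrite !natrM; field.
by rewrite ltr_pM2r // ltr_nat; lia.
Qed.

Lemma cos_ang_gt0 d h : (h < d)%N -> 0 < cos (ang d h).
Proof.
move=> /ang_itv/andP[h1 h2]; apply: cos_gt0_pihalf; rewrite h2 andbT.
by rewrite (lt_trans _ h1) // oppr_lt0 divr_gt0 ?pi_gt0.
Qed.

Lemma cos_ang_inj d h k : (h < d)%N -> (k < d)%N ->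
  cos (ang d h) = cos (ang d k) -> h = k.
Proof.
move=> hd kd E.
have itv j : (j < d)%N -> ang d j \in `[0, pi].
  move=> /ang_itv/andP[h1 h2]; rewrite in_itv /= ltW //= (le_trans (ltW h2)) //.
  by rewrite ler_piMr ?pi_ge0 // invf_le1 // ler1n.
have := cos_inj (itv _ hd) (itv _ kd) E; rewrite /ang.
have d0 : (4 * d)%:R != 0 :> R by rewrite pnatr_eq0; lia.
have pi0 : (pi : R) != 0 by rewrite gt_eqF // pi_gt0.
move/(mulIf (invr_neq0 d0))/(mulIf pi0)/eqP; rewrite eqr_nat => /eqP; lia.
Qed.

Lemma cos_odd_pihalf h : cos ((2 * h + 1)%:R * pi / 2 : R) = 0.
Proof.
elim: h => [|h IH]; first by rewrite mul1r cos_pihalf.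
rewrite (_ : _ / 2 = (2 * h + 1)%:R * pi / 2 + pi).
  by rewrite cosDpi IH oppr0.
by rewrite !natrD !natrM -natr1; field.
Qed.

Lemma cos_2d_ang d h : (0 < d)%N -> cos ((2 * d)%:R * ang d h) = 0.
Proof.
move=> d0; rewrite -[RHS](cos_odd_pihalf h) /ang; congr cos.
have d1 : d%:R != 0 :> R by rewrite pnatr_eq0; lia.
by rewrite !natrM; field.
Qed.

Definition evec (d h j : nat) : R := (-1) ^+ j * sin ((2 * j)%:R * ang d h).

(** The factor (-1)^j turns the eigenvalue 2 - 2 cos 2a of the sine vector into 2 + 2 cos 2a = 4
    (cos a)^2. *)
Lemma evec_rec d h j :
  evec d h j.+1 *+ 2 - evec d h j - evec d h j.+2 =
  4 * cos (ang d h) ^+ 2 * evec d h j.+1.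
Proof.
rewrite /evec; set a := ang d h.
have -> : (2 * j)%:R * a = (2 * j.+1)%:R * a - a *+ 2.
  by rewrite !natrM -natr1; ring.
have -> : (2 * j.+2)%:R * a = (2 * j.+1)%:R * a + a *+ 2.
  by rewrite !natrM -natr1; ring.
rewrite sinB (sinD _ (a *+ 2)) cos_mulr2n sin_mulr2n !exprS; ring.
Qed.

Lemma evec0 d h : evec d h 0 = 0.
Proof. by rewrite /evec muln0 mul0r sin0 mulr0. Qed.

(** Since cos(2da) = 0, both sines reduce to sin(2da) cos(2a), and the two signs agree. *)
Lemma evec_reflect d h : (0 < d)%N -> evec d h d.+1 = evec d h d.-1.
Proof.
case: d => // d _; rewrite /evec /=; set a := ang _ h.
have c0 : cos ((2 * d.+1)%:R * a) = 0 by apply: cos_2d_ang.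
have -> : (2 * d)%:R * a = (2 * d.+1)%:R * a - a *+ 2.
  by rewrite !natrM -natr1; ring.
have -> : (2 * d.+2)%:R * a = (2 * d.+1)%:R * a + a *+ 2.
  by rewrite !natrM -natr1; ring.
by rewrite sinB (sinD _ (a *+ 2)) c0 !exprS; ring.
Qed.

Definition emx n : 'M[R]_n := \matrix_(i, h) evec n h i.+1.
Definition eval n (h : nat) : R := 4 * cos (ang n h) ^+ 2.
Definition rlap n : 'M[R]_n := map_mx intr (fold_lap n).

Definition eval_mx n k : 'M[R]_n := diag_mx (\row_h eval n h ^+ k).

Lemma rlap_emx n : rlap n *m emx n = emx n *m eval_mx n 1.
Proof.
case: n => [|n]; first by apply/matrixP => [] [].
rewrite mul_mx_diag; apply/matrixP => i h; rewrite !mxE mulrC -evec_rec.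
rewrite -(fold_lap_sum i (evec0 _ h) (evec_reflect _ _)) //.
by apply: eq_bigr => k _; rewrite !mxE.
Qed.

(* The first entries of the [rlap n ^+ k *m emx n] form a Vandermonde matrix
   in the eigenvalues, with columns rescaled by nonzero sines. *)
Lemma emx_unit n : emx n \in unitmx.
Proof.
case: n => [|n]; first by rewrite unitmxE det_mx00 unitr1.
have pow k : rlap n.+1 ^+ k *m emx n.+1 = emx n.+1 *m eval_mx n.+1 k.
  elim: k => [|k IH].
    rewrite expr0 mul1mx /eval_mx (_ : \row_h _ = const_mx 1) ?diag_const_mx ?mulmx1 //.
    by apply/matrixP => i h; rewrite !mxE.
  rewrite exprSr -mulmxA rlap_emx mulmxA IH -mulmxA mulmx_diag.
  by congr (_ *m diag_mx _); apply/matrixP => i h; rewrite !mxE expr1 -exprSr.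
pose B : 'M[R]_n.+1 := \matrix_(k, i) (rlap n.+1 ^+ k) ord0 i.
pose s : 'rV[R]_n.+1 := \row_h emx n.+1 ord0 h.
pose l : 'rV[R]_n.+1 := \row_h eval n.+1 h.
have E : B *m emx n.+1 = Vandermonde n.+1 l *m diag_mx s.
  rewrite mul_mx_diag; apply/matrixP => k h.
  have := congr1 (fun M : 'M[R]_n.+1 => M ord0 h) (pow k); rewrite /eval_mx mul_mx_diag.
  rewrite !mxE mulrC => <-; apply: eq_bigr => j _; by rewrite !mxE.
rewrite unitmxE unitfE; apply/eqP => d0.
have /eqP := congr1 determinant E; rewrite !det_mulmx d0 mulr0 eq_sym mulf_eq0.
rewrite det_Vandermonde det_diag => /orP[] /eqP/eqP; apply/negP.
  apply/prodf_neq0 => i _; apply/prodf_neq0 => j ij; rewrite !mxE subr_eq0 /eval.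
  rewrite (inj_eq (mulfI _)) ?pnatr_eq0 // eqrXn2 ?ltW ?cos_ang_gt0 //.
  by apply/eqP => /cos_ang_inj; rewrite !ltn_ord => /(_ isT isT); lia.
apply/prodf_neq0 => i _; rewrite !mxE /evec expr1 mulN1r oppr_eq0 gt_eqF //.
apply: sin_gt0_pi; have /andP[h1 h2] := ang_itv (ltn_ord i).
rewrite muln1; apply/andP; split; first by apply: mulr_gt0.
by rewrite mulrC -ltr_pdivlMr.
Qed.

(** Tensor products of eigenvectors diagonalise the Kronecker sum, with sums of eigenvalues; the
    nonzero determinant of the eigenvector matrix cancels. *)
Lemma det_rlap2 m n : (\det (fold_lap2 m n))%:~R =
  \prod_(h < m) \prod_(k < n) (4 * cos (ang m h) ^+ 2 + 4 * cos (ang n k) ^+ 2) :> R.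
Proof.
case: m n => [|m] [|n].
- by rewrite big_ord0 det_mx00.
- by rewrite big_ord0 det_mx00.
- rewrite big1 => [|i _]; last by rewrite big_ord0.
  by move: (fold_lap2 _ _); rewrite muln0 => M; rewrite det_mx00.
pose d : 'rV[R]_(m.+1 * n.+1) :=
  \row_k (eval m.+1 (mxtens_unindex k).1 + eval n.+1 (mxtens_unindex k).2).
have mapL : map_mx intr (fold_lap2 m.+1 n.+1) =
            rlap m.+1 *t 1%:M + 1%:M *t rlap n.+1 :> 'M[R]_(_ * _).
  by rewrite map_mxD !map_mxT !map_mx1.
have E : map_mx intr (fold_lap2 m.+1 n.+1) *m (emx m.+1 *t emx n.+1) =
         (emx m.+1 *t emx n.+1) *m diag_mx d.
  rewrite mapL mulmxDl !tensmx_mul !mul1mx !rlap_emx /eval_mx !mul_mx_diag.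
  apply/matrixP => i j; case: (mxtens_indexP i) => a b; case: (mxtens_indexP j) => c e.
  rewrite [LHS]mxE [RHS]mxE !tensmxE !mxE mxtens_indexK /= !expr1; ring.
have := congr1 determinant E; rewrite !det_mulmx mulrC det_map_mx => /mulfI ->.
  rewrite det_diag pair_bigA /= (reindex (@mxtens_index m.+1 n.+1)) /=.
    by apply: eq_bigr => i _; rewrite mxE mxtens_indexK.
  by exists (@mxtens_unindex m.+1 n.+1) => i _; rewrite ?mxtens_indexK ?mxtens_unindexK.
rewrite -unitfE -unitmxE; apply: tensmx_unit => //; exact: emx_unit.
Qed.
End Eigen.

(** * Chebyshev polynomials *)

(** Carries the factorisation found over the reals to a complex argument. *)
Lemma map_chebyshevT (K L : nzRingType) (f : {rmorphism K -> L}) j :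
  map_poly f (chebyshevT K j) = chebyshevT L j.
Proof.
have H : map_poly f (chebyshevT K j) = chebyshevT L j /\
         map_poly f (chebyshevT K j.+1) = chebyshevT L j.+1.
  elim: j => [|j [IH1 IH2]]; first by rewrite /= rmorph1 map_polyX.
  split=> //; rewrite [chebyshevT K _]/= [chebyshevT L _]/=.
  rewrite rmorphB rmorphM /= map_polyZ /= map_polyX rmorph_nat.
  by rewrite -[X in _ * X - _]/(map_poly f (chebyshevT K j.+1)) IH1 IH2.
by case: H.
Qed.

Lemma chebyshevT_cos (R : realType) j (x : R) : (chebyshevT R j).[cos x] = cos (j%:R * x).
Proof.
have H : (chebyshevT R j).[cos x] = cos (j%:R * x) /\
         (chebyshevT R j.+1).[cos x] = cos (j.+1%:R * x).
  elim: j => [|j [IH1 IH2]]; first by rewrite /= hornerC hornerX mul0r cos0 mul1r.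
  split=> //; rewrite [chebyshevT R _]/= hornerD hornerN hornerM hornerZ hornerX.
  rewrite -[X in _ * X.[_] - _]/(chebyshevT R j.+1) IH1 IH2.
  have -> : j%:R * x = j.+1%:R * x - x by rewrite -natr1; ring.
  have -> : j.+2%:R * x = j.+1%:R * x + x by rewrite -!natr1; ring.
  by rewrite cosB cosD; ring.
by case: H.
Qed.

Lemma chebyshevT_size_lead (K : numDomainType) j :
  size (chebyshevT K j.+1) = j.+2 /\ lead_coef (chebyshevT K j.+1) = 2 ^+ j.
Proof.
have H : (size (chebyshevT K j) = j.+1) /\
   (size (chebyshevT K j.+1) = j.+2 /\ lead_coef (chebyshevT K j.+1) = 2 ^+ j).
  elim: j => [|j [IH1 [IH2 IH3]]]; first by rewrite size_poly1 size_polyX lead_coefX.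
  have p0 : chebyshevT K j.+1 != 0 by rewrite -size_poly_gt0 IH2.
  have s2 : size (2%:R *: 'X * chebyshevT K j.+1) = j.+3.
    by rewrite -scalerAl size_scale ?pnatr_eq0 // mulrC size_mulX // IH2.
  split=> //; rewrite -[chebyshevT K j.+2]/(2%:R *: 'X * chebyshevT K j.+1 - chebyshevT K j).
  have lt : (size (- chebyshevT K j)%R < size (2%:R *: 'X * chebyshevT K j.+1)%R)%N.
    by rewrite size_polyN IH1 s2.
  rewrite size_polyDl // s2; split=> //.
  by rewrite lead_coefDl // -scalerAl lead_coefZ ['X * _]mulrC lead_coefMX IH3 exprS.
by case: H.
Qed.

(** The numbers cos(ang k) and -cos(ang k) are 2n distinct roots of a polynomial of degree 2n with
    leading coefficient 2^(2n-1). *)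
Lemma chebyshevT_even_roots (R : realType) n : (0 < n)%N ->
  chebyshevT R (2 * n) = 2 ^+ (2 * n).-1 *:
    \prod_(k < n) (('X - (cos (ang R n k))%:P) * ('X + (cos (ang R n k))%:P)).
Proof.
move=> n0; pose c k := cos (ang R n k).
pose rs := [seq c k | k <- iota 0 n] ++ [seq - c k | k <- iota 0 n].
have nE : (2 * n = (2 * n).-1.+1)%N by lia.
have [sz ld] := chebyshevT_size_lead R (2 * n).-1; rewrite -nE in sz ld.
have cr k : (k < n)%N -> (chebyshevT R (2 * n)).[c k] = 0.
  by move=> kn; rewrite chebyshevT_cos cos_2d_ang.
have crN k : (k < n)%N -> (chebyshevT R (2 * n)).[- c k] = 0.
  (* Here -cos x = cos(x + pi), and 2n(x + pi) differs from 2nx by n full periods. *)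
  move=> kn; rewrite -cosDpi chebyshevT_cos mulrDr.
  rewrite (_ : (2 * n)%:R * pi = (pi *+ 2) *+ n); last by rewrite natrM; ring.
  by rewrite (periodicn (@cosD2pi R)) cos_2d_ang.
have nd j : size [seq c k | k <- iota 0 j] = j by rewrite size_map size_iota.
have us : uniq rs.
  rewrite /rs cat_uniq !map_inj_in_uniq ?iota_uniq ?andbT /=; last 2 first.
  - by move=> k l; rewrite !mem_iota !add0n => kn ln /oppr_inj/cos_ang_inj; apply.
  - by move=> k l; rewrite !mem_iota !add0n => kn ln /cos_ang_inj; apply.
  apply/hasPn => _ /mapP[k + ->]; rewrite mem_iota add0n => kn.
  apply/negP => /mapP[l]; rewrite mem_iota add0n => ln E.
  have := cos_ang_gt0 R kn; have := cos_ang_gt0 R ln; rewrite -/(c k) -/(c l); lra.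
rewrite [LHS](@all_roots_prod_XsubC _ _ rs) ?uniq_rootsE //; last 2 first.
- by rewrite sz /rs size_cat !size_map size_iota; lia.
- apply/allP => x; rewrite mem_cat => /orP[] /mapP[k]; rewrite mem_iota add0n => kn ->.
    by rewrite /root cr.
  by rewrite /root crN.
have iE : iota 0 n = index_iota 0 n by rewrite /index_iota subn0.
rewrite ld big_cat !big_map big_split /=; congr (_ *: (_ * _)).
  by rewrite iE big_mkord.
rewrite iE big_mkord; apply: eq_bigr => k _.
by rewrite polyCN opprK.
Qed.

(** Each pair of factors gives (iz - x)(iz + x) = -(z^2 + x^2); the signs are absorbed by (-1)^n,
    and twice 2^(2n-1) is 4^n. *)
Lemma chebyshevT_imaginary (R : realType) n (z : R) : (0 < n)%N ->
  (-1) ^+ n * 2 * (chebyshevT R[i] (2 * n)).['i%C * z%:C%C] =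
  (\prod_(k < n) (4 * z ^+ 2 + 4 * cos (ang R n k) ^+ 2))%:C%C.
Proof.
move=> n0; rewrite -(map_chebyshevT (real_complex R)) chebyshevT_even_roots //.
rewrite map_polyZ rmorph_prod hornerZ horner_prod /= rmorphXn /= rmorph_nat.
rewrite mulrA -(mulrA ((-1) ^+ n)) -exprS prednK; last by lia.
rewrite exprM -exprMn -[n in _ ^+ n]card_ord -prodr_const -big_split /= rmorph_prod.
apply: eq_bigr => k _; rewrite rmorphM rmorphB rmorphD /= map_polyX map_polyC /=.
rewrite hornerM !hornerE /=; move: (cos _) => x.
rewrite rmorphD !rmorphM /= rmorph_nat.
transitivity (- 4 * ('i%C ^+ 2 * (z%:C%C * z%:C%C) - x%:C%C * x%:C%C) : R[i]); first by ring.
by rewrite sqr_i; ring.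
Qed.

(** * Counting a cokernel *)

Lemma card_ord_lt B k : (k <= B)%N -> #|[pred t : 'I_B | (t < k)%N]| = k.
Proof.
by move=> kB; rewrite -sum1_card -(big_ord_widen _ (fun=> 1%N) kB) sum1_card card_ord.
Qed.

(** The two hypotheses on [f] make it a bijection from [S] to the cokernel of [A]. For the Smith
    form A = L D R, a class is given by the remainders of the coordinates of L^-1 f(c) modulo the
    diagonal of D. *)
Lemma coker_card N (A : 'M[int]_N) (T : Type) (S : set T) (f : T -> 'cV[int]_N) :
  \det A != 0 ->
  (forall c d, S c -> S d -> (exists u, f c - f d = A *m u) -> c = d) ->
  (forall z, exists c u, S c /\ f c = z + A *m u) ->
  (S #= `I_(`|\det A|%N))%card.
Proof.
move=> A0 f_inj f_surj.
have [L Lu [R Ru [d _ AE]]] := int_Smith_normal_form A.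
set D := \matrix_(_, _) _ in AE.
pose e (i : 'I_N) : int := d`_i.
have DE : D = diag_mx (\row_i e i).
  by apply/matrixP => i j; rewrite !mxE.
have absu (M : 'M[int]_N) : M \in unitmx -> `|\det M|%N = 1%N.
  move=> Mu; have := congr1 (fun X => `|\det X|%N) (mulmxV Mu).
  by rewrite det_mulmx det1 abszM => /eqP; rewrite muln_eq1 => /andP[/eqP].
have detA : `|\det A|%N = (\prod_(i < N) `|e i|)%N.
  rewrite AE !det_mulmx !abszM (absu L) // (absu R) // mul1n muln1 DE det_diag.
  by rewrite (big_morph absz abszM (erefl _)); apply: eq_bigr => i _; rewrite mxE.
have d0 (i : 'I_N) : e i != 0.
  apply/eqP => di; move: A0; rewrite -absz_eq0 detA (bigD1 i) //= di.
  by rewrite mul0n.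
have DM (w : 'cV[int]_N) i : (D *m w) i 0 = e i * w i 0.
  by rewrite DE mul_diag_mx !mxE.
pose g c := invmx L *m f c.
pose y c i : int := g c i 0.
have gA u : invmx L *m (A *m u) = D *m (R *m u).
  by rewrite AE -!mulmxA mulKmx.
(* A common bound puts all remainders into one finite type; [F] restricts each to its own
   modulus. *)
pose B := \max_(i < N) `|e i|%N.
have dB (i : 'I_N) : (`|e i| <= B.+1)%N by apply/leqW/leq_bigmax.
pose F (i : 'I_N) := [pred t : 'I_B.+1 | (t < `|e i|)%N].
pose G c := [ffun i : 'I_N => inord `|(y c i %% e i)%Z|%N : 'I_B.+1].
have GE c i : (G c i)%:Z = (y c i %% e i)%Z.
  have := modz_ge0 (y c i) (d0 i); have := ltz_mod (y c i) (d0 i).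
  have := dB i; rewrite ffunE => h1 h2 h3; rewrite inordK; last by lia.
  by rewrite gez0_abs.
have GF c : G c \in family F.
  apply/familyP => i; rewrite inE; have := ltz_mod (y c i) (d0 i); rewrite -GE; lia.
have cardF : #|family F| = `|\det A|%N.
  rewrite detA card_family foldrE big_image /=.
  by apply: eq_bigr => i _; apply: card_ord_lt.
apply/card_set_bijP; exists (fun c => index (G c) (enum (family F))); split.
- move=> c _ /=; rewrite -cardF cardE index_mem mem_enum; exact: GF.
- move=> c c' ;rewrite !inE => Sc Sc' E; apply: f_inj => //.
  have {E} GG : G c = G c' by apply: (@index_inj _ (G c) (enum (family F))) => //;
    rewrite mem_enum.
  have dv i : exists q, y c i - y c' i = e i * q.
    have /eqP : (y c i = y c' i %[mod e i])%Z by rewrite -!GE GG.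
    by rewrite eqz_mod_dvd => /dvdzP[q ->]; exists q; rewrite mulrC.
  have /fin_all_exists[q qE] := dv.
  (* R^-1 applied to the quotients is the preimage under A of the difference. *)
  exists (invmx R *m \col_i q i); have Lu' : invmx L \in unitmx by rewrite unitmx_inv.
  apply: (can_inj (mulKmx Lu')).
  rewrite gA mulKVmx // mulmxBr; apply/matrixP => i j; rewrite (ord1 j) DM -/(g c) -/(g c').
  by rewrite !mxE -qE /y /g !mxE.
- move=> k /=; rewrite -cardF cardE => kF.
  have t0 : {ffun 'I_N -> 'I_B.+1} := [ffun=> ord0].
  pose t := nth t0 (enum (family F)) k.
  have tF : t \in family F by rewrite -mem_enum mem_nth.
  have [c [u [Sc cE]]] := f_surj (L *m \col_i (t i)%:Z).
  exists c => //; suff -> : G c = t by rewrite /t index_uniq ?enum_uniq.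
  apply/ffunP => i; apply: val_inj; apply/eqP; rewrite -eqz_nat GE /y /g cE mulmxDr mulKmx // gA.
  rewrite mxE DM mxE addrC mulrC modzMDl -modz_abs modz_small //.
  by move/familyP/(_ i): tF; rewrite inE ltz_nat.
Qed.

(** * Sandpiles on the grid *)

Section Sandpile.
Variables p q : nat.
Notation V := (grid p q).
Notation conf := (config p q).
Notation reach := (clos_refl_trans conf (@firing_step p q)).

(** The reduced Laplacian of the sandpile graph, without the row and column of the sink. *)
Definition lap (u : V -> int) (v : V) : int :=
  4 * u v - \sum_w (grid_adj v w)%:R * u w.

Definition vdelta (v w : V) : int := (w == v)%:R.

Lemma lapD u u' v : lap (fun w => u w + u' w) v = lap u v + lap u' v.
Proof.
rewrite /lap; under eq_bigr do rewrite mulrDr.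
by rewrite big_split /=; ring.
Qed.

Lemma lapZ k u v : lap (fun w => k * u w) v = k * lap u v.
Proof.
rewrite /lap mulrBr mulr_sumr; congr (_ - _); first by ring.
by apply: eq_bigr => w _; ring.
Qed.

Lemma eq_lap u u' : u =1 u' -> lap u =1 lap u'.
Proof. by move=> E v; rewrite /lap E; congr (_ - _); apply: eq_bigr => w _; rewrite E. Qed.

Lemma lap_delta v w : lap (vdelta v) w = 4 * (w == v)%:R - (grid_adj v w)%:R.
Proof.
rewrite /lap /vdelta; congr (_ - _).
rewrite (bigD1 v) //= eqxx mulr1 grid_adjC big1 ?addr0 // => x /negbTE ->.
by rewrite mulr0.
Qed.

Lemma grid_adj_irr (v : V) : grid_adj v v = false.
Proof. by rewrite grid_adjE /natadj; lia. Qed.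

Lemma fireE (c : conf) v w : unstable c v ->
  (fire c v w)%:Z = (c w)%:Z - lap (vdelta v) w.
Proof.
rewrite /unstable => cv; rewrite lap_delta ffunE; case: eqP => [->|_].
  by rewrite grid_adj_irr; lia.
by case: grid_adj; lia.
Qed.

(** Least action principle, by induction on the firing sequence. If u v = u' v when the unstable v
    fires next, then u <= u' elsewhere leaves v at least as full after u' as after u, so u' does not
    stabilise. *)
Lemma least_action (c d : conf) : reach c d -> exists u : V -> int,
  [/\ forall v, 0 <= u v,
      forall v, (d v)%:Z = (c v)%:Z - lap u v &
      forall u' : V -> int, (forall v, 0 <= u' v) ->
        (forall v, (c v)%:Z - lap u' v < 4) -> forall v, u v <= u' v].
Proof.
move=> cd; have {cd} := clos_rt_rtn1 _ _ _ _ cd.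
elim=> [|y z [v [yv ->]] _ [u [u0 yE ule]]].
  exists (fun=> 0); split=> // v; rewrite /lap big1 => [|w _]; rewrite ?mulr0 //; lia.
exists (fun w => u w + vdelta v w); split=> [w|w|u' u'0 st w].
- by rewrite addr_ge0 // /vdelta; case: (_ == _).
- by rewrite fireE // yE lapD; ring.
- have le := ule _ u'0 st; rewrite /vdelta; case: eqP => [->|_]; last by rewrite addr0.
  rewrite mulr1n lezD1 lt_neqAle le andbT; apply/eqP => uv.
  have := st v; move: yv; rewrite /unstable -lez_nat yE /lap uv.
  have : \sum_w (grid_adj v w)%:R * u w <= \sum_w (grid_adj v w)%:R * u' w.
    by apply: ler_sum => x _; apply: ler_wpM2l.
  by lia.
Qed.

Lemma stableP (c : conf) : reflect (forall v, (c v)%:Z < 4) (stable c).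
Proof.
apply: (iffP forallP) => H v; have := H v; rewrite /unstable; lia.
Qed.

(** By least action the two firing vectors bound each other. *)
Lemma stabilizes_to_fun (c d d' : conf) :
  stabilizes_to c d -> stabilizes_to c d' -> d = d'.
Proof.
move=> [/least_action[u [u0 dE ule]] /stableP sd] [/least_action[u' [u'0 dE' ule']] /stableP sd'].
have uu : u =1 u'.
  move=> v; apply/eqP; rewrite eq_le ule //=; last by move=> w; rewrite -dE'.
  by rewrite ule' // => w; rewrite -dE.
by apply/ffunP => v; apply/eqP; rewrite -eqz_nat dE dE' (eq_lap uu).
Qed.

Lemma reach_add (b c d : conf) : reach c d ->
  reach [ffun v => (b v + c v)%N] [ffun v => (b v + d v)%N].
Proof.
elim=> [x y [v [xv ->]]|x|x y z _ IH1 _ IH2].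
- apply: rt_step; exists v; rewrite /unstable ffunE; split.
    by apply: leq_trans xv _; apply: leq_addl.
  apply/ffunP => w; rewrite !ffunE; move: xv; rewrite /unstable.
  by case: eqP => [->|_] xv; lia.
- exact: rt_refl.
- exact: rt_trans IH1 IH2.
Qed.

(* In 1-based coordinates this is a (p + 1 - a) b (q + 1 - b), a product of two
   concave parabolas that vanish where the sink edges start, hence strictly
   superharmonic. *)
Definition hump (v : V) : int :=
  (v.1.+1 * (p - v.1))%N%:Z * (v.2.+1 * (q - v.2))%N%:Z.

(** [F] lives on 1-based coordinates and vanishes on a frame around the grid, which replaces the
    neighbours missing at the border. *)
Lemma sum_adj (F : nat -> nat -> int) (v : V) :
  (forall b, F 0%N b = 0) -> (forall b, F p.+1 b = 0) ->
  (forall a, F a 0%N = 0) -> (forall a, F a q.+1 = 0) ->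
  \sum_w (grid_adj v w)%:R * F w.1.+1 w.2.+1 =
  F v.1 v.2.+1 + F v.1.+2 v.2.+1 + F v.1.+1 v.2 + F v.1.+1 v.2.+2.
Proof.
move=> F0 Fp G0 Gq; case: v => x y /=.
have step r (f : nat -> int) (i : 'I_r) : f 0%N = 0 -> f r.+1 = 0 ->
   \sum_(j < r) ((i.+1 == j :> nat)%:R + (j.+1 == i :> nat)%:R) * f j.+1 = f i + f i.+2.
  move=> f0 fr; under eq_bigr do rewrite mulrDl.
  rewrite big_split /= addrC; congr (_ + _).
    have := ltn_ord i; case: (nat_of_ord i) => [|k] kr.
      by rewrite f0 big1 // => j _; rewrite mul0r.
    under eq_bigr do rewrite eqSS eq_sym.
    rewrite (bigD1 (Ordinal (ltnW kr))) //= eqxx mul1r big1 ?addr0 // => j.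
    by rewrite -val_eqE /= eq_sym => /negbTE ->; rewrite mul0r.
  have [ir|ir] := ltnP i.+1 r.
    rewrite (bigD1 (Ordinal ir)) //= eqxx mul1r big1 ?addr0 // => j.
    by rewrite -val_eqE /= eq_sym => /negbTE ->; rewrite mul0r.
  have -> : i.+2 = r.+1 by have := ltn_ord i; lia.
  by rewrite fr big1 // => j _; case: eqP => [E|_]; rewrite ?mul0r //; have := ltn_ord j; lia.
rewrite -(pair_bigA _ (fun i j => (grid_adj (x, y) (i, j))%:R * F i.+1 j.+1)) /=.
transitivity (\sum_(i < p) ((x.+1 == i :> nat)%:R + (i.+1 == x :> nat)%:R) * F i.+1 y.+1
            + \sum_(j < q) ((y.+1 == j :> nat)%:R + (j.+1 == y :> nat)%:R) * F x.+1 j.+1).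
  rewrite [X in _ = _ + X](_ : _ = \sum_(i < p) (i == x)%:R *
     \sum_(j < q) ((y.+1 == j :> nat)%:R + (j.+1 == y :> nat)%:R) * F i.+1 j.+1); last first.
    rewrite [RHS](bigD1 x) //= eqxx mul1r [X in _ = _ + X]big1 ?addr0 //.
    by move=> i /negbTE ->; rewrite mul0r.
  rewrite -big_split /=; apply: eq_bigr => i _.
  rewrite [X in _ = X + _](_ : _ = \sum_(j < q) (j == y)%:R *
     (((x.+1 == i :> nat)%:R + (i.+1 == x :> nat)%:R) * F i.+1 j.+1)); last first.
    rewrite [RHS](bigD1 y) //= eqxx mul1r [X in _ = _ + X]big1 ?addr0 //.
    by move=> j /negbTE ->; rewrite mul0r.
  rewrite mulr_sumr -big_split /=; apply: eq_bigr => j _.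
  rewrite !mulrA -mulrDl; congr (_ * _); rewrite grid_adjE /natadj /= -!val_eqE /=.
  by do 6?[case: eqP => ?] => //=; lia.
by rewrite (step _ (fun a => F a y.+1)) // (step _ (fun b => F x.+1 b)) // !addrA.
Qed.

Lemma lapE (F : nat -> nat -> int) (v : V) :
  (forall b, F 0%N b = 0) -> (forall b, F p.+1 b = 0) ->
  (forall a, F a 0%N = 0) -> (forall a, F a q.+1 = 0) ->
  lap (fun w => F w.1.+1 w.2.+1) v =
  (F v.1.+1 v.2.+1 *+ 2 - F v.1 v.2.+1 - F v.1.+2 v.2.+1) +
  (F v.1.+1 v.2.+1 *+ 2 - F v.1.+1 v.2 - F v.1.+1 v.2.+2).
Proof. by move=> *; rewrite /lap sum_adj //; ring. Qed.

Lemma hump_ge1 v : 1 <= hump v.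
Proof.
rewrite /hump -PoszM lez_nat !muln_gt0 /= !subn_gt0; by rewrite !ltn_ord.
Qed.

(** Both parabolas have second difference -2, so the Laplacian is twice their sum. *)
Lemma lap_hump_ge1 v : 1 <= lap hump v.
Proof.
pose F (a b : nat) : int := (a%:Z * (p.+1%:Z - a%:Z)) * (b%:Z * (q.+1%:Z - b%:Z)).
have hE : hump =1 (fun w => F w.1.+1 w.2.+1).
  move=> w; rewrite /hump /F; have := ltn_ord w.1; have := ltn_ord w.2 => h1 h2.
  by rewrite !PoszM -!subzn ?(ltnW h1) ?(ltnW h2) //; congr ((_ * _) * (_ * _)); lia.
rewrite (eq_lap hE) lapE; try by move=> a; rewrite /F ?subrr ?mul0r ?mulr0 ?mul0r.
have := ltn_ord v.1; have := ltn_ord v.2.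
move: (nat_of_ord v.1) (nat_of_ord v.2) => a b bq ap; rewrite /F.
rewrite [X in _ <= X](_ : _ = 2 * (b.+1%:Z * (q.+1%:Z - b.+1%:Z))
  + 2 * (a.+1%:Z * (p.+1%:Z - a.+1%:Z))).
  by nia.
by rewrite !intS; ring.
Qed.

Lemma lap_sym u u' : \sum_v u v * lap u' v = \sum_v lap u v * u' v.
Proof.
rewrite /lap; under eq_bigr do rewrite mulrBr mulr_sumr.
rewrite sumrB exchange_big /= -sumrB; apply: eq_bigr => v _.
rewrite mulrBl mulr_suml; congr (_ - _); first by ring.
by apply: eq_bigr => w _; rewrite grid_adjC; ring.
Qed.

(** By symmetry of [lap], firing v lowers the grain count weighted by [hump] by [lap hump v], which
    is at least 1. *)
Lemma stabilizes_ex (c : conf) : exists d, stabilizes_to c d.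
Proof.
have [k] := ubnP (absz (\sum_v hump v * (c v)%:Z)).
elim: k c => // k IH c ck.
have [st|] := boolP (stable c); first by exists c; split=> //; apply: rt_refl.
rewrite negb_forall => /existsP[v]; rewrite negbK => cv.
have h0 (w : V) : 0 <= hump w by apply: le_trans (hump_ge1 w).
have [|d [r sd]] := IH (fire c v).
  have E : \sum_w hump w * (fire c v w)%:Z = \sum_w hump w * (c w)%:Z - lap hump v.
    under eq_bigr do rewrite fireE // mulrBr.
    rewrite sumrB lap_sym; congr (_ - _); rewrite (bigD1 v) //= /vdelta eqxx mulr1.
    by rewrite big1 ?addr0 // => w /negbTE ->; rewrite mulr0.
  have s0 (e : conf) : 0 <= \sum_w hump w * (e w)%:Z.
    by apply: sumr_ge0 => w _; apply: mulr_ge0.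
  have := s0 c; have := s0 (fire c v); have := lap_hump_ge1 v; rewrite E; lia.
by exists d; split=> //; apply: rt_trans r; apply: rt_step; exists v.
Qed.
End Sandpile.

(** * Recurrents and their classes modulo the Laplacian *)

Section Recurrent.
Variables p q : nat.
Notation V := (grid p q).
Notation conf := (config p q).
Notation reach := (clos_refl_trans conf (@firing_step p q)).

(** If u v > 0 then y v >= 5 u v, because the neighbours take away at most the rest of the sum of
    [u]. So v can fire, and induction applies to the remaining firings. *)
Lemma reach_lap (u : V -> nat) (x y : conf) :
  (forall v, \sum_w u w <= x v)%N ->
  (forall v, (y v)%:Z = (x v)%:Z + lap (fun w => (u w)%:Z) v) -> reach y x.
Proof.
have [k] := ubnP (\sum_w u w)%N; elim: k u x y => // k IH u x y uk ux yE.
have [/eqP u0|] := boolP (\sum_w u w == 0)%N.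
  have {}u0 w : u w = 0%N.
    by apply/eqP; move/eqP: u0; rewrite sum_nat_eq0 => /forallP/(_ w).
  have -> : y = x; last exact: rt_refl.
  apply/ffunP => v; apply/eqP; rewrite -eqz_nat yE /lap u0 big1 => [|w _]; last first.
    by rewrite u0 mulr0.
  by rewrite mulr0 subrr addr0.
rewrite sum_nat_eq0 negb_forall => /existsP[v]; rewrite /= -lt0n => uv.
have sumE : (\sum_w u w = u v + \sum_(w | w != v) u w)%N by rewrite (bigD1 v).
have yv : unstable y v.
  rewrite /unstable -lez_nat yE /lap /=; set s : int := \sum_w _.
  have : s <= (\sum_(w | w != v) u w)%N%:Z.
    rewrite /s (bigD1 v) //= grid_adj_irr mul0r add0r (big_morph Posz PoszD (erefl _)).
    by apply: ler_sum => w _; case: grid_adj; rewrite ?mul1r ?mul0r.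
  have := ux v; rewrite sumE; move: uv; clearbody s.
  move: (\sum_(w | w != v) u w)%N => t. move: (x v) (u v) s => xv uv s. lia.
pose u' w := (u w - (w == v))%N.
have u'E w : (u w)%:Z = (u' w)%:Z + vdelta v w.
  by rewrite /u' /vdelta; case: eqP => [->|_]; lia.
have sumE' : (\sum_w u' w = (\sum_w u w).-1)%N.
  rewrite sumE (bigD1 v) //= {1}/u' eqxx (eq_bigr u) => [|w /negbTE wv].
    by move: uv; move: (u v) (\sum_(w | w != v) u w)%N => a t; lia.
  by rewrite /u' wv subn0.
apply: rt_trans (IH u' x (fire y v) _ _ _).
- by apply: rt_step; exists v.
- by rewrite sumE'; lia.
- by move=> w; rewrite sumE'; have := ux w; lia.
- move=> w; rewrite fireE // yE (eq_lap u'E) lapD; ring.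
Qed.

(** Take x stabilising to c and large enough for [reach_lap]. Then b + x reaches x, hence c, but
    also b + c; stabilisation being unique, b + c stabilises to c. *)
Lemma recurrent_absorb (c b : conf) (u : V -> nat) :
  recurrent c -> (forall v, (b v)%:Z = lap (fun w => (u w)%:Z) v) ->
  stabilizes_to [ffun v => (b v + c v)%N] c.
Proof.
move=> [sc rc] bE; have [b' [xc _]] := rc [ffun=> (\sum_w u w)%N].
set x := finfun _ in xc.
have rx : reach [ffun v => (b v + x v)%N] x.
  apply: (@reach_lap u) => v; last by rewrite ffunE PoszD bE addrC.
  by rewrite !ffunE leq_addr.
have [d [rd sd]] := stabilizes_ex [ffun v => (b v + c v)%N].
have E : d = c.
  apply: (@stabilizes_to_fun _ _ [ffun v => (b v + x v)%N]); split=> //.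
    by apply: rt_trans rd; apply: reach_add.
  exact: rt_trans xc.
by rewrite -{2}E.
Qed.

(** As [u] may have any sign, it is written as the difference of K hump + u and K hump; for this K,
    both and their Laplacians are nonnegative. Adding the first Laplacian to c and the second to d
    gives one configuration, which stabilises to both. *)
Lemma recurrent_uniq (c d : conf) (u : V -> int) :
  recurrent c -> recurrent d -> (forall v, (d v)%:Z = (c v)%:Z + lap u v) -> c = d.
Proof.
move=> rc rd dE.
pose K : nat := (\sum_v (`|u v| + `|lap u v|))%N.
have KP v : (`|u v| + `|lap u v| <= K)%N by rewrite /K (bigD1 v) //= leq_addr.
pose h (v : V) : nat := absz (K%:Z * hump v).
have hE v : (h v)%:Z = K%:Z * hump v.
  by rewrite /h gez0_abs // mulr_ge0 // (le_trans _ (hump_ge1 v)).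
pose g (v : V) : nat := absz (K%:Z * hump v + u v).
have gE v : (g v)%:Z = K%:Z * hump v + u v.
  by rewrite /g gez0_abs //; have := hump_ge1 v; have := KP v; nia.
pose bh : conf := [ffun v => absz (K%:Z * lap (@hump p q) v)].
pose bg : conf := [ffun v => absz (K%:Z * lap (@hump p q) v + lap u v)].
have bhE v : (bh v)%:Z = K%:Z * lap (@hump p q) v.
  by rewrite ffunE gez0_abs // mulr_ge0 // (le_trans _ (lap_hump_ge1 v)).
have bgE v : (bg v)%:Z = K%:Z * lap (@hump p q) v + lap u v.
  by rewrite ffunE gez0_abs //; have := lap_hump_ge1 v; have := KP v; nia.
clearbody bh bg.
have sc : stabilizes_to [ffun v => (bg v + c v)%N] c.
  apply: (recurrent_absorb (u := g)) => // v.
  by rewrite bgE (eq_lap gE) lapD lapZ.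
have sd : stabilizes_to [ffun v => (bh v + d v)%N] d.
  by apply: (recurrent_absorb (u := h)) => // v; rewrite bhE (eq_lap hE) lapZ.
have E : [ffun v => (bg v + c v)%N] = [ffun v => (bh v + d v)%N].
  apply/ffunP => v; rewrite !ffunE; apply/eqP; rewrite -eqz_nat !PoszD bgE bhE dE.
  by apply/eqP; ring.
by apply: stabilizes_to_fun sc _; rewrite E.
Qed.

(** * Reflections of the grid and symmetric recurrents *)

Definition flip1 (v : V) : V := (rev_ord v.1, v.2).
Definition flip2 (v : V) : V := (v.1, rev_ord v.2).

Lemma flip1K : involutive flip1.
Proof. by case=> a b; rewrite /flip1 /= rev_ordK. Qed.

Lemma flip2K : involutive flip2.
Proof. by case=> a b; rewrite /flip2 /= rev_ordK. Qed.

Lemma grid_adj_flip1 v w : grid_adj (flip1 v) (flip1 w) = grid_adj v w.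
Proof.
rewrite !grid_adjE /natadj /=; move: (ltn_ord v.1) (ltn_ord w.1).
move: (nat_of_ord v.1) (nat_of_ord w.1) (nat_of_ord v.2) (nat_of_ord w.2) => a b c d.
by move=> ? ?; apply/idP/idP; lia.
Qed.

Lemma grid_adj_flip2 v w : grid_adj (flip2 v) (flip2 w) = grid_adj v w.
Proof.
rewrite !grid_adjE /natadj /=; move: (ltn_ord v.2) (ltn_ord w.2).
move: (nat_of_ord v.1) (nat_of_ord w.1) (nat_of_ord v.2) (nat_of_ord w.2) => a b c d.
by move=> ? ?; apply/idP/idP; lia.
Qed.

Lemma lap_flip (f : V -> V) (u : V -> int) v : involutive f ->
  (forall v w, grid_adj (f v) (f w) = grid_adj v w) ->
  lap (fun w => u (f w)) v = lap u (f v).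
Proof.
move=> fK fadj; rewrite /lap; congr (_ - _).
rewrite [RHS](reindex_inj (inv_inj fK)) /=.
by apply: eq_bigr => w _; rewrite fadj.
Qed.

Lemma hump_flip1 v : hump (flip1 v) = hump v.
Proof.
rewrite /hump /=; congr (Posz _ * _); have := ltn_ord v.1.
by move: (nat_of_ord v.1) => a ap; rewrite mulnC; congr (_ * _)%N; lia.
Qed.

Lemma hump_flip2 v : hump (flip2 v) = hump v.
Proof.
rewrite /hump /=; congr (_ * Posz _); have := ltn_ord v.2.
by move: (nat_of_ord v.2) => a ap; rewrite mulnC; congr (_ * _)%N; lia.
Qed.

(* By the least action principle a symmetry of the initial configuration is a
   symmetry of the firing vector. *)
Lemma stabilize_flip (f : V -> V) (y c : conf) (u : V -> int) :
  involutive f -> (forall v w, grid_adj (f v) (f w) = grid_adj v w) ->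
  (forall v, y (f v) = y v) -> stable c -> (forall v, 0 <= u v) ->
  (forall v, (c v)%:Z = (y v)%:Z - lap u v) ->
  (forall u' : V -> int, (forall v, 0 <= u' v) ->
     (forall v, (y v)%:Z - lap u' v < 4) -> forall v, u v <= u' v) ->
  forall v, u (f v) = u v /\ c (f v) = c v.
Proof.
move=> fK fadj yf /stableP sc u0 cE least.
have le v : u v <= u (f v).
  apply: (least (fun w => u (f w))) => // w.
  by rewrite lap_flip // -yf -cE.
have uf v : u (f v) = u v by apply/eqP; rewrite eq_le le -{2}[v]fK le.
move=> v; split=> //; apply/eqP; rewrite -eqz_nat !cE yf -lap_flip //.
by rewrite (eq_lap uf).
Qed.

Lemma symmetric_flip (c : conf) :
  symmetric_config c <-> (forall v, c (flip1 v) = c v) /\ (forall v, c (flip2 v) = c v).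
Proof.
split=> [H|[H1 H2] a b]; first by split=> [] [a b]; have [] := H a b.
by have := H1 (a, b); have := H2 (a, b); rewrite /flip1 /flip2 /= => -> ->.
Qed.

(** A large multiple of the Laplacian of [hump] moves z to a symmetric y >= 3 of the same class. Its
    stabilisation is symmetric, and recurrent because y dominates every stable configuration. *)
Lemma symmetric_recurrent_ex (z : V -> int) :
  (forall v, z (flip1 v) = z v) -> (forall v, z (flip2 v) = z v) ->
  exists (c : conf) (u : V -> int), [/\ symmetric_recurrents p q c,
    forall v, u (flip1 v) = u v, forall v, u (flip2 v) = u v &
    forall v, (c v)%:Z = z v + lap u v].
Proof.
move=> z1 z2.
pose K : nat := (3 + \sum_v `|z v|)%N.
have KP v : (3 + `|z v| <= K)%N by rewrite /K (bigD1 v) //= addnA leq_addr.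
pose y : conf := [ffun v => absz (z v + K%:Z * lap (@hump p q) v)].
have yE v : (y v)%:Z = z v + K%:Z * lap (@hump p q) v.
  by rewrite ffunE gez0_abs //; have := lap_hump_ge1 v; have := KP v; nia.
have y3 v : (3 <= y v)%N.
  by rewrite -lez_nat yE; have := lap_hump_ge1 v; have := KP v; nia.
have [c [yc sc]] := stabilizes_ex y.
have [u [u0 cE least]] := least_action yc.
have lap1 v : lap (@hump p q) (flip1 v) = lap (@hump p q) v.
  rewrite -(lap_flip _ _ flip1K grid_adj_flip1); exact: eq_lap hump_flip1 v.
have lap2 v : lap (@hump p q) (flip2 v) = lap (@hump p q) v.
  rewrite -(lap_flip _ _ flip2K grid_adj_flip2); exact: eq_lap hump_flip2 v.
have y1 v : y (flip1 v) = y v by rewrite !ffunE lap1 z1.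
have y2 v : y (flip2 v) = y v by rewrite !ffunE lap2 z2.
clearbody y.
have s1 := stabilize_flip flip1K grid_adj_flip1 y1 sc u0 cE least.
have s2 := stabilize_flip flip2K grid_adj_flip2 y2 sc u0 cE least.
exists c, (fun v => K%:Z * hump v + (-1) * u v); split.
- split; last by apply/symmetric_flip; split=> v; [case: (s1 v) | case: (s2 v)].
  split=> // a; have [a' [aa' /stableP sa']] := stabilizes_ex a.
  (* As a' <= 3 <= y the subtraction is exact, and a + (y - a') reaches y. *)
  exists [ffun v => (y v - a' v)%N]; split=> //.
  apply: rt_trans yc.
  have := reach_add [ffun v => (y v - a' v)%N] aa'.
  have -> : [ffun v => ([ffun v0 => (y v0 - a' v0)%N] v + a' v)%N] = y.
    by apply/ffunP => v; rewrite !ffunE subnK // (leq_trans _ (y3 v)) // -ltnS -ltz_nat sa'.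
  by congr reach; apply/ffunP => v; rewrite !ffunE addnC.
- by move=> v; rewrite hump_flip1 (s1 v).1.
- by move=> v; rewrite hump_flip2 (s2 v).1.
- by move=> v; rewrite cE yE lapD !lapZ; ring.
Qed.
End Recurrent.

(** * Folding symmetric functions onto a quadrant *)

Section Fold.
Variables m' n' : nat.
Notation m := m'.+1.
Notation n := n'.+1.
Notation p := (2 * m - 1)%N.
Notation q := (2 * n - 1)%N.
Notation V := (grid p q).

(** Folds 0, ..., 2r at the axis r; both ends, where the frame lies, go to 0. *)
Definition foldn r (a : nat) : nat := minn a (2 * r - a).

Definition ext (x : 'cV[int]_(m * n)) (a b : nat) : int :=
  if (a == 0%N) || (b == 0%N) then 0
  else x (mxtens_index (inord a.-1, inord b.-1)) 0.

Definition unf (x : 'cV[int]_(m * n)) (v : V) : int :=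
  ext x (foldn m v.1.+1) (foldn n v.2.+1).

Lemma corner_subproof r (i : 'I_r.+1) : (i < 2 * r.+1 - 1)%N.
Proof. by have := ltn_ord i; lia. Qed.

Definition corner (ij : 'I_m * 'I_n) : V :=
  (Ordinal (corner_subproof ij.1), Ordinal (corner_subproof ij.2)).

Definition vec (z : V -> int) : 'cV[int]_(m * n) :=
  \col_k z (corner (mxtens_unindex k)).

Definition flip_inv (z : V -> int) :=
  (forall v, z (flip1 v) = z v) /\ (forall v, z (flip2 v) = z v).

Lemma unf_flip_inv x : flip_inv (unf x).
Proof.
split=> v; rewrite /unf /=; congr ext; rewrite /foldn.
  have := ltn_ord v.1; move: (nat_of_ord v.1) => a; lia.
have := ltn_ord v.2; move: (nat_of_ord v.2) => a; lia.
Qed.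

Lemma lap_flip_inv u : flip_inv u -> flip_inv (lap u).
Proof.
move=> [u1 u2]; split=> v.
  by rewrite -(lap_flip _ _ (@flip1K _ _) (@grid_adj_flip1 _ _)) (eq_lap u1).
by rewrite -(lap_flip _ _ (@flip2K _ _) (@grid_adj_flip2 _ _)) (eq_lap u2).
Qed.

(** At most two reflections bring a vertex into the quadrant read by [vec]. *)
Lemma flip_inv_eq z z' : flip_inv z -> flip_inv z' -> vec z = vec z' -> z =1 z'.
Proof.
move=> [z1 z2] [z'1 z'2] E.
have cornerE ij : z (corner ij) = z' (corner ij).
  have /matrixP/(_ (mxtens_index ij) 0) := E.
  by rewrite !mxE mxtens_indexK.
have low (v : V) : (v.1 < m)%N -> (v.2 < n)%N -> z v = z' v.
  move=> v1 v2; rewrite (_ : v = corner (Ordinal v1, Ordinal v2)) //.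
  by case: v v1 v2 => a b v1 v2; congr pair; apply: val_inj.
have low1 (v : V) : (v.1 < m)%N -> z v = z' v.
  move=> v1; have [|v2] := ltnP v.2 n; first exact: low.
  rewrite -z2 -z'2; apply: low => //=; move: (ltn_ord v.2) v2.
  by move: (nat_of_ord v.2) => a; lia.
move=> v; have [|v1] := ltnP v.1 m; first exact: low1.
rewrite -z1 -z'1; apply: low1 => /=; move: (ltn_ord v.1) v1.
by move: (nat_of_ord v.1) => a; lia.
Qed.

Lemma foldn_low r (i : 'I_r.+1) : foldn r.+1 i.+1 = i.+1.
Proof. by rewrite /foldn; have := ltn_ord i; lia. Qed.

Lemma ext_low x (i : 'I_m) (j : 'I_n) : ext x i.+1 j.+1 = x (mxtens_index (i, j)) 0.
Proof. by rewrite /ext /= !inord_val. Qed.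

Lemma vec_unf x : vec (unf x) = x.
Proof.
apply/matrixP => k z; rewrite (ord1 z) !mxE.
case: (mxtens_indexP k) => i j; rewrite mxtens_indexK /unf /= !foldn_low.
exact: ext_low.
Qed.

(** Folded coordinates vanish on the frame and agree on the two sides of the axis, so [fold_lap_sum]
    turns the two second differences of [lapE] into the two Kronecker summands. *)
Lemma vec_lap_unf x : vec (lap (unf x)) = fold_lap2 m n *m x.
Proof.
apply/matrixP => k z; rewrite (ord1 z) [LHS]mxE.
case: (mxtens_indexP k) => i j; rewrite mxtens_indexK.
pose F a b := ext x (foldn m a) (foldn n b).
have ext0 b : ext x 0 b = 0 by [].
have ext0' a : ext x a 0 = 0 by rewrite /ext orbT.
have foldn0 r : foldn r 0 = 0%N by rewrite /foldn min0n.
have foldnT r : foldn r.+1 (2 * r.+1 - 1).+1 = 0%N by rewrite /foldn; lia.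
rewrite -[unf x]/(fun w : V => F w.1.+1 w.2.+1) lapE; last 4 first.
- by move=> b; rewrite /F foldn0.
- by move=> b; rewrite /F foldnT.
- by move=> b; rewrite /F foldn0.
- by move=> b; rewrite /F foldnT.
have refl r : foldn r.+1 r.+2 = foldn r.+1 r by rewrite /foldn; lia.
have /= <- := @fold_lap_sum int m (fun a => F a j.+1) i; last first.
- by rewrite /F refl.
- by rewrite /F foldn0.
have /= <- := @fold_lap_sum int n (fun b => F i.+1 b) j; last first.
- by rewrite /F refl.
- by rewrite /F foldn0.
rewrite mxE (reindex (@mxtens_index m n)) /=; last first.
  by exists (@mxtens_unindex m n) => c _; rewrite ?mxtens_indexK ?mxtens_unindexK.
rewrite [RHS](eq_bigr (fun ab : 'I_m * 'I_n => fold_lap2 m n (mxtens_index (i, j))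
     (mxtens_index (ab.1, ab.2)) * x (mxtens_index (ab.1, ab.2)) 0)); last by case.
rewrite -(pair_bigA _ (fun a b => fold_lap2 m n (mxtens_index (i, j)) (mxtens_index (a, b)) *
     x (mxtens_index (a, b)) 0)) /=.
(* Each single sum is padded with a Kronecker delta to a double sum. *)
rewrite [X in X + _](_ : _ = \sum_a \sum_b (fold_lap m i a * (j == b)%:R) *
    x (mxtens_index (a, b)) 0); last first.
  apply: eq_bigr => a _; rewrite (bigD1 j) //= eqxx mulr1 big1 ?addr0.
    by rewrite intz /F !foldn_low ext_low.
  by move=> b; rewrite eq_sym => /negbTE ->; rewrite mulr0 mul0r.
rewrite [X in _ + X](_ : _ = \sum_a \sum_b ((i == a)%:R * fold_lap n j b) *
    x (mxtens_index (a, b)) 0); last first.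
  rewrite [RHS](bigD1 i) //= eqxx [X in _ = _ + X]big1 ?addr0.
    by apply: eq_bigr => b _; rewrite intz mul1r /F !foldn_low ext_low.
  by move=> a; rewrite eq_sym => /negbTE ->; rewrite big1 // => b _; rewrite !mul0r.
rewrite -big_split /=; apply: eq_bigr => a _; rewrite -big_split /=; apply: eq_bigr => b _.
by rewrite -mulrDl /fold_lap2; congr (_ * _); rewrite [RHS]mxE !tensmxE !mxE.
Qed.

(** A congruence of quadrant vectors lifts to symmetric functions on the grid, where
    [recurrent_uniq] gives injectivity and [symmetric_recurrent_ex] surjectivity. *)
Lemma card_symmetric_recurrents : \det (fold_lap2 m n) != 0 ->
  (symmetric_recurrents p q #= `I_(`|\det (fold_lap2 m n)|%N))%card.
Proof.
move=> d0; apply: (coker_card (f := fun c : config p q => vec (fun v => (c v)%:Z))) => //.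
- move=> c d [rc /symmetric_flip[c1 c2]] [rd /symmetric_flip[d1 d2]] [u E].
  apply: (recurrent_uniq (u := unf (- u))) => // v.
  suff H : (fun v => (d v)%:Z - (c v)%:Z) =1 lap (unf (- u)).
    by rewrite -H addrC subrK.
  apply: flip_inv_eq; first by split=> w; rewrite ?c1 ?c2 ?d1 ?d2.
    exact/lap_flip_inv/unf_flip_inv.
  rewrite vec_lap_unf mulmxN -E opprB.
  by apply/matrixP => k l; rewrite !mxE.
- move=> z; have [z1 z2] := unf_flip_inv z.
  have [c [u [Sc u1 u2 cE]]] := symmetric_recurrent_ex z1 z2.
  exists c, (vec u); split=> //.
  rewrite -vec_lap_unf -[in LHS]/(vec _).
  have ue : u =1 unf (vec u).
    by apply: flip_inv_eq; rewrite ?vec_unf //; exact: unf_flip_inv.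
  rewrite -[in RHS](vec_unf z); apply/matrixP => k l; rewrite !mxE cE.
  by rewrite (eq_lap ue).
Qed.
End Fold.

(** * Equality of the four numbers *)

Unset Implicit Arguments.
Local Open Scope card_scope.

Theorem theorem4p10 (R : realType) (m n : nat) (hm : (1 <= m)%N) (hn : (1 <= n)%N) :
  let N := weighted_domino_tilings m n in
  [/\ symmetric_recurrents (2 * m - 1)%N (2 * n - 1)%N #= `I_N,
      N%:R = (-1) ^+ (m * n) * 2 ^+ m *
             \prod_(1 <= h < m.+1)
               (chebyshevT R[i] (2 * n)%N).['i%C * (zeta R h m)%:C%C] :> R[i]
    & N%:R = \prod_(1 <= h < m.+1) \prod_(1 <= k < n.+1)
               (4 * zeta R h m ^+ 2 + 4 * zeta R k n ^+ 2) :> R].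
Proof.
move=> N; set P := \prod_(1 <= h < m.+1) _; set P' := \prod_(1 <= h < m.+1) _.
have P'E : P' = \prod_(h < m) \prod_(k < n)
    (4 * cos (ang R m h) ^+ 2 + 4 * cos (ang R n k) ^+ 2).
  rewrite /P' big_add1 big_mkord; apply: eq_bigr => h _.
  by rewrite big_add1 big_mkord; apply: eq_bigr => k _; rewrite !zetaE.
have P'det : (\det (fold_lap2 m n))%:~R = P' by rewrite P'E det_rlap2.
(* Positivity removes the absolute value and gives the nonsingularity that the cokernel count
   requires. *)
have det_gt0 : 0 < \det (fold_lap2 m n).
  rewrite -(ltr0z R) P'det P'E; apply: prodr_gt0 => h _; apply: prodr_gt0 => k _.
  by apply: addr_gt0; apply: mulr_gt0 => //; apply: exprn_gt0; apply: cos_ang_gt0.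
have NE : N = `|\det (fold_lap2 m n)|%N by apply: weighted_domino_tilings_det.
have NP' : N%:R = P' by rewrite -P'det NE pmulrn gez0_abs // ltW.
split=> //.
- rewrite NE; case: m n hm hn {N P P' P'E P'det NE NP'} det_gt0 => // m [] // n _ _ d0.
  by apply: card_symmetric_recurrents; rewrite gt_eqF.
- have -> : N%:R = (P')%:C%C :> R[i] by rewrite -NP' rmorph_nat.
  (* The sign and the power of 2 are shared out, one factor (-1)^n 2 for each h. *)
  rewrite P'E rmorph_prod /= /P big_add1 big_mkord mulnC exprM -exprMn.
  rewrite -[m in _ ^+ m]card_ord -prodr_const -big_split /=.
  by apply: eq_bigr => h _; rewrite zetaE chebyshevT_imaginary.
Qed.
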